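(* Let $W$ be a finite irreducible real reflection group and let $m\ge 1$ be an integer. Let $\mathcal{C}$ be a conjugacy class of $W$ (of the form of the parabolic type of some face). Then the set $\{ f\in\Gamma^{(m)} : f \text{ has parabolic type } \mathcal{C}\}$ is stable under the action of the dihedral group $\langle \mathcal{R},\mathcal{S}\rangle\subset \operatorname{Aut}(\Gamma^{(m)})$ generated by $\mathcal{R}$ and $\mathcal{S}$, where $\Gamma^{(m)}$ is the generalized cluster complex of $W$.
   Context: Reflection group data. $W$ is a finite irreducible real reflection group of rank $n$ acting on its geometric representation $V\simeq\mathbb{R}^n$, with root system $\Phi$, simple roots $\Pi$, positive roots $\Phi_+$; $t_\alpha$ is the reflection associated with $\alpha\in\Phi$ and $T$ is the set of all reflections. Fix a partition $\Pi=\Pi_\circ\uplus\Pi_\bullet$ such that each of $\Pi_\circ,\Pi_\bullet$ consists of pairwise orthogonal roots. Put $c_\bullet=\prod_{\alpha\in\Pi_\bullet}t_\alpha$, $c_\circ=\prod_{\alpha\in\Pi_\circ}t_\alpha$, $c=c_\bullet c_\circ$ (bipartite Coxeter element); $h$ is the order of $c$ (Coxeter number). By Steinberg, $\Phi=\biguplus_{i=1}^{2h}\Pi_{(i)}$ where (indices mod $2h$) $\Pi_{(2k+1)}=c^k(\Pi_\bullet)$ and $\Pi_{(2k)}=c^k(-\Pi_\circ)$; one has $\Phi_+=\biguplus_{i=1}^h\Pi_{(i)}$, $\Pi_{(1)}=\Pi_\bullet$, $\Pi_{(h)}=\Pi_\circ$, $c_\bullet(\Pi_{(i)})=\Pi_{(h+2-i)}$,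 $c_\circ(\Pi_{(i)})=\Pi_{(h-i)}$, $-\Pi_{(i)}=\Pi_{(i+h)}$. Noncrossing partitions. $\ell(w)$ is the minimal number of reflections whose product is $w$; the absolute order is $u\le v\iff \ell(u)+\ell(u^{-1}v)=\ell(v)$; $\mathrm{NC}=\{\pi\in W: \pi\le c\}$ and $\mathrm{NC}_k=\{\pi\in \mathrm{NC}:\ell(\pi)=k\}$. Generalized cluster complex. A colored root is a pair $\alpha^i=(\alpha,i)$ with $\alpha\in\Phi$, $1\le i\le m$. The set $\Phi^{(m)}_{\ge-1}$ of almost positive colored roots consists of the $\alpha^i$ with $\alpha\in\Phi_+$, $1\le i\le m$, and the $\alpha^1$ with $-\alpha\in\Pi$. It is the disjoint union of blocks $\varPi_{(i)}$, $0\le i\le mh+1$ (indices mod $mh+2$): $\varPi_{(0)}=(-\Pi_\circ)^1$, $\varPi_{(mh+1)}=(-\Pi_\bullet)^1$, and $\varPi_{(ih+j)}=\Pi_{(j)}^{m-i}$ for $0\le i\le m-1$, $1\le j\le h$ (where $X^i=\{\alpha^i:\alpha\in X\}$). For $f\subset\Phi^{(m)}_{\ge-1}$ let $f_{(i)}=\prod_{\alpha\in f\cap\varPi_{(i)}}t_\alpha$ (forgetting colors; the factors commute), and $\prod f=f_{(mh+1)}\cdots f_{(1)}f_{(0)}$. The simplicial complex $\Gamma^{(m)}$ has as faces the subsets $f$ with $\prod f\in \mathrm{NC}_{|f|}$. Parabolic type. For $f\in\Gamma^{(m)}$ let $\underline{f}=(\prod f)^{-1}c\in\mathrm{NC}$.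 For $\pi\in\mathrm{NC}$, $W_\pi=\{w\in W:\operatorname{Fix}(\pi)\subset\operatorname{Fix}(w)\}$, where $\operatorname{Fix}(w)=\ker(1_W-w)\subset V$; this is a parabolic subgroup having $\pi$ as a Coxeter element. The parabolic type of $f$ is the conjugacy class of the parabolic subgroup $W_{\underline f}$, equivalently viewed as the conjugacy class of $\underline f$ in $W$. Dihedral action. The maps $\mathcal{R},\mathcal{S}:\Phi^{(m)}_{\ge-1}\to\Phi^{(m)}_{\ge-1}$ are: $\mathcal{R}(\alpha^i)=\alpha^{i+1}$ if $\alpha\in\Phi_+$, $i<m$; $\mathcal{R}(\alpha^i)=(-\alpha)^1$ if ($\alpha\in\Pi_\circ$ and $i=m$) or ($-\alpha\in\Pi_\bullet$ and $i=1$); $\mathcal{R}(\alpha^i)=c(\alpha)^1$ if ($\alpha\in\Phi_+\setminus\Pi_\circ$ and $i=m$) or ($-\alpha\in\Pi_\circ$ and $i=1$). $\mathcal{S}(\alpha^i)=\alpha^i$ if $\alpha\in-\Pi_\circ$, $i=1$; $(-\alpha)^m$ if $\alpha\in-\Pi_\bullet$, $i=1$; $(-\alpha)^1$ if $\alpha\in\Pi_\bullet$, $i=m$; $\alpha^{m-i}$ if $\alpha\in\Pi_\bullet$, $1\le i\le m-1$; $c_\bullet(\alpha)^{m+1-i}$ if $\alpha\in\Phi_+\setminus\Pi_\bullet$. It is known that $\mathcal{R},\mathcal{S}$ induce automorphisms of $\Gamma^{(m)}$ with $\mathcal{R}^{mh+2}=\mathcal{S}^2=(\mathcal{R}\mathcal{S})^2=\mathrm{id}$.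 *)

(* Defs.v *)
From HB Require Import structures.
From mathcomp Require Import all_boot all_order all_algebra all_fingroup all_character.
From mathcomp Require Import boolp reals.

Set Implicit Arguments.
Unset Strict Implicit.
Unset Printing Implicit Defensive.

Import Order.TTheory GRing.Theory Num.Theory GroupScope.
Local Open Scope ring_scope.

(* V = R^n is the space of column vectors with its standard inner product, so  *)
(* that a product x * y of W acts by first applying y, as in c = c_b c_w.       *)

Section Reflections.
Variables (R : realType) (n : nat).

Definition dot (u v : 'cV[R]_n) : R := (u^T *m v) 0 0.

Definition refl_mx (a : 'cV[R]_n) : 'M[R]_n :=
  1%:M - (2 / dot a a) *: (a *m a^T).

End Reflections.

Section ReflectionGroup.
Variables (R : realType) (n : nat) (gT : finGroupType) (W : {group gT}).
Variable rW : mx_representation R W n.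
Local Notation V := 'cV[R]_n.

Definition is_reflection (w : gT) : Prop :=
  exists a : V, a != 0 /\ rW w = refl_mx a.

Definition reflections : {set gT} := [set w in W | `[< is_reflection w >]].

(* mx_irreducible is about invariant subspaces of row vectors; as W acts by   *)
(* orthogonal matrices, transposition turns them into those of V.              *)
Record irreducible_reflection_group : Prop := {
  rg_orthogonal : {in W, forall w, (rW w)^T *m rW w = 1%:M};
  rg_faithful : mx_faithful rW;
  rg_irreducible : mx_irreducible rW;
  rg_generated : <<reflections>>%g = W
}.

(* The lengths of the roots are not fixed, only membership in Phi is used, and *)
(* the simple roots are indexed by 'I_n: [black] is the set of indices of      *)
(* \Pi_\bullet, and its complement that of \Pi_\circ.                          *)
Record root_data := RootData {
  Phi : seq V;
  Pi : n.-tuple V;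
  black : {set 'I_n};
  Phi_neq0 : {in Phi, forall a, a != 0};
  Phi_stable : {in W & Phi, forall w a, rW w *m a \in Phi};
  Phi_reduced : {in Phi, forall (a : V) (k : R), k *: a \in Phi -> k = 1 \/ k = -1};
  Phi_reflection : {in Phi, forall a, exists2 w, w \in W & rW w = refl_mx a};
  reflection_Phi : {in reflections, forall w, exists2 a, a \in Phi & rW w = refl_mx a};
  Pi_Phi : {subset Pi <= Phi};
  Pi_basis : basis_of {:V} Pi;
  Phi_sign : {in Phi, forall a, (forall i, 0 <= coord Pi i a) \/
                                (forall i, coord Pi i a <= 0)};
  Pi_bipartite : forall i j, i != j -> (i \in black) = (j \in black) ->
                   dot (tnth Pi i) (tnth Pi j) = 0
}.

Section RootSystem.
Variable D : root_data.

Definition positive (a : V) : bool :=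
  (a \in Phi D) && [forall i, 0 <= coord (Pi D) i a].

Definition PiB : seq V := [seq tnth (Pi D) i | i in black D].
Definition PiW : seq V := [seq tnth (Pi D) i | i in ~: black D].

(* For a root a, the element of W acting as the reflection t_a. *)
Definition t (a : V) : gT := repr [set w in W | rW w == refl_mx a].

Definition cB : gT := (\prod_(i in black D) t (tnth (Pi D) i))%g.
Definition cW : gT := (\prod_(i in ~: black D) t (tnth (Pi D) i))%g.
Definition cox : gT := (cB * cW)%g.
Definition coxnum : nat := #[cox].

(* \Pi_(2k+1) = c^k(\Pi_\bullet) and \Pi_(2k) = c^k(- \Pi_\circ). *)
Definition Pi_layer (i : nat) : seq V :=
  [seq rW (cox ^+ i./2)%g *m a | a <- if odd i then PiB else map -%R PiW].

(* The minimal length of a factorization into reflections; T ^+ k is the set  *)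
(* of products of k reflections, and a shortest factorization of an element    *)
(* of W has fewer than #|W| factors.                                           *)
Definition abs_length (w : gT) : nat :=
  find (fun k => w \in (reflections ^+ k)%g) (iota 0 #|W|).

Definition abs_le (u v : gT) : bool :=
  (abs_length u + abs_length (u^-1 * v)%g == abs_length v)%N.

Definition NC : {set gT} := [set p in W | abs_le p cox].
Definition NC_ (k : nat) : {set gT} := [set p in NC | abs_length p == k].

Definition Fix (w : gT) : {vspace V} := fixedSpace (linfun (mulmx (rW w))).

Definition parabolic (p : gT) : {set gT} := [set w in W | (Fix p <= Fix w)%VS].

Section Colored.
Variable m : nat.

Definition colored_roots : seq (V * nat) :=
  [seq (a, i) | a <- [seq a <- Phi D | positive a], i <- iota 1 m]
    ++ [seq (- a, 1%N) | a <- Pi D].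

Definition croot : finType := seq_sub colored_roots.

(* For 0 < k < m h + 1, k = q h + j with 1 <= j <= h, i.e., k.-1 = q h + j.-1. *)
Definition block (k : nat) : seq (V * nat) :=
  let h := coxnum in
  if k == 0%N then [seq (- a, 1%N) | a <- PiW]
  else if k == (m * h).+1 then [seq (- a, 1%N) | a <- PiB]
  else [seq (a, m - k.-1 %/ h)%N | a <- Pi_layer (k.-1 %% h).+1].

Implicit Type f : {set croot}.

(* The factors commute, so the order of the product is irrelevant. *)
Definition block_prod f (k : nat) : gT :=
  (\prod_(x in f | ssval x \in block k) t (ssval x).1)%g.

Definition face_prod f : gT :=
  (\prod_(k < (m * coxnum).+2) block_prod f ((m * coxnum).+1 - k))%g.

Definition Gamma : {set {set croot}} := [set f | face_prod f \in NC_ #|f|].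

Definition coface f : gT := ((face_prod f)^-1 * cox)%g.

Definition parabolic_type f : {set {set gT}} := parabolic (coface f) :^: W.
Definition parabolic_type_elt f : {set gT} := coface f ^: W.

Definition Rraw (x : V * nat) : V * nat :=
  let: (a, i) := x in
  if positive a && (i < m)%N then (a, i.+1)
  else if (a \in PiW) && (i == m) || (- a \in PiB) && (i == 1%N)
  then (- a, 1%N)
  else (rW cox *m a, 1%N).

Definition Sraw (x : V * nat) : V * nat :=
  let: (a, i) := x in
  if (- a \in PiW) && (i == 1%N) then (a, i)
  else if (- a \in PiB) && (i == 1%N) then (- a, m)
  else if a \in PiB then
    if i == m then (- a, 1%N) else (a, m - i)%N
  else (rW cB *m a, m.+1 - i)%N.

End Colored.
End RootSystem.

Section Permutations.
Variable D : root_data.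
Implicit Types a b u v : V.

(* The maps Rraw and Sraw are permutations of the set of colored roots. *)

Local Notation al := (tnth (Pi D)).
Local Notation cf := (coord (Pi D)).

Definition prod_refl (J : {set 'I_n}) : gT := (\prod_(i in J) t (al i))%g.

Definition refl_coef (i : 'I_n) (v : V) : R := 2 / dot (al i) (al i) * dot (al i) v.

Lemma dotE (a v : V) : a^T *m v = (dot a v)%:M.
Proof. exact: mx11_scalar. Qed.

Lemma dot_gt0 (a : V) : a != 0 -> 0 < dot a a.
Proof.
have -> : dot a a = \sum_i a i 0 ^+ 2.
  by rewrite /dot !mxE; apply: eq_bigr => i _; rewrite !mxE expr2.
move=> a_neq0; rewrite lt0r sumr_ge0 ?andbT => [|i _]; last exact: sqr_ge0.
apply: contraNneq a_neq0 => /psumr_eq0P a0.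
apply/eqP/matrixP => i j; rewrite ord1 mxE; apply/eqP.
by rewrite -sqrf_eq0 a0 // => k _; apply: sqr_ge0.
Qed.

Lemma refl_mxE (a v : V) : refl_mx a *m v = v - (2 / dot a a * dot a v) *: a.
Proof.
rewrite mulmxBl mul1mx -scalemxAl -mulmxA dotE.
by rewrite mul_mx_scalar scalerA.
Qed.

Lemma al_Phi i : al i \in Phi D.
Proof. exact/Pi_Phi/mem_tnth. Qed.

Lemma tP a : a \in Phi D -> t a \in W /\ rW (t a) = refl_mx a.
Proof.
move=> /(Phi_reflection (r := D)) [w wW rw].
have /mem_repr : w \in [set w in W | rW w == refl_mx a] by rewrite inE wW rw /=.
by rewrite inE => /andP[? /eqP].
Qed.

Lemma cfE (v : V) : v = \sum_i cf i v *: al i.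
Proof.
rewrite {1}(coord_basis (Pi_basis D) (memvf v)).
by apply: eq_bigr => i _; rewrite -tnth_nth.
Qed.

Lemma cf_al i j : cf i (al j) = (j == i)%:R.
Proof. by rewrite (tnth_nth 0) coord_free // (basis_free (Pi_basis D)). Qed.

Lemma al_inj : injective al.
Proof.
move=> i j eq_ij; have := cf_al i i; rewrite eq_ij cf_al eqxx.
by case: eqP => // _ /eqP; rewrite eq_sym oner_eq0.
Qed.

Lemma cf_inj (u v : V) : (forall i, cf i u = cf i v) -> u = v.
Proof. by move=> uv; rewrite (cfE u) (cfE v); apply: eq_bigr => i _; rewrite uv. Qed.

Lemma prod_reflE (J : {set 'I_n}) (v : V) :
    {in J &, forall i j, i != j -> dot (al i) (al j) = 0} ->
  rW (prod_refl J) *m v = v - \sum_(i in J) refl_coef i v *: al i.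
Proof.
move=> orthJ; rewrite /prod_refl -big_filter -[in RHS]big_filter.
set s := [seq i <- _ | _].
have: {subset s <= J} by move=> i; rewrite mem_filter => /andP[].
have: uniq s by rewrite filter_uniq // index_enum_uniq.
elim: s v => [|j s IHs] v /=.
  by move=> _ _; rewrite !big_nil subr0 repr_mx1 mul1mx.
case/andP=> js us sJ.
have jJ : j \in J by apply: sJ; rewrite mem_head.
have {}sJ : {subset s <= J} by move=> i si; apply: sJ; rewrite inE si orbT.
rewrite !big_cons.
have [tW tj] := tP (al_Phi j).
have sW : (\prod_(i <- s) t (al i))%g \in W.
  by apply: group_prod => i _; case: (tP (al_Phi i)).
rewrite repr_mxM // -mulmxA IHs // mulmxBr tj refl_mxE mulmx_sumr.
rewrite opprD addrA; congr (_ - _).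
rewrite big_seq [RHS]big_seq; apply: eq_bigr => i si.
have ji : j != i by apply: contraNneq js => ->.
by rewrite -scalemxAr refl_mxE (orthJ _ _ jJ (sJ i si) ji) mulr0 scale0r subr0.
Qed.

Section Orthogonal.
Variable J : {set 'I_n}.
Hypothesis orthJ : {in J &, forall i j, i != j -> dot (al i) (al j) = 0}.

Lemma prod_refl_W : prod_refl J \in W.
Proof. by apply: group_prod => i _; case: (tP (al_Phi i)). Qed.

Lemma prod_refl_Phi a : a \in Phi D -> rW (prod_refl J) *m a \in Phi D.
Proof. by apply: Phi_stable; apply: prod_refl_W. Qed.

Lemma refl_coef_al i : refl_coef i (al i) = 2.
Proof.
by rewrite /refl_coef divfK // gt_eqF // dot_gt0 // (Phi_neq0 (al_Phi i)).
Qed.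

Lemma prod_refl_al i : i \in J -> rW (prod_refl J) *m al i = - al i.
Proof.
move=> iJ; rewrite prod_reflE // (bigD1 i) //= big1 => [|j /andP[jJ ji]].
  by rewrite addr0 refl_coef_al scaler_nat mulr2n opprD addrA subrr sub0r.
by rewrite /refl_coef (orthJ jJ iJ ji) mulr0 scale0r.
Qed.

Lemma prod_reflK : involutive (fun v : V => rW (prod_refl J) *m v).
Proof.
move=> v; rewrite [in X in _ *m X]prod_reflE // mulmxBr mulmx_sumr.
rewrite [in X in X - _]prod_reflE //.
under [X in _ - X]eq_bigr => i iJ do rewrite -scalemxAr prod_refl_al // scalerN.
by rewrite sumrN opprK subrK.
Qed.

Lemma cf_prod_refl i v : i \notin J -> cf i (rW (prod_refl J) *m v) = cf i v.
Proof.
move=> iJ; rewrite prod_reflE // linearB linear_sum /= big1 ?subr0 // => j jJ.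
rewrite linearZ /= cf_al; case: eqP => [ji|_]; last by rewrite mulr0.
by rewrite -ji jJ in iJ.
Qed.

Lemma positive_cf_gt0 a : positive D a -> a \notin [seq al i | i in J] ->
  exists2 i, i \notin J & 0 < cf i a.
Proof.
case/andP=> aPhi /forallP a_ge0 aJ.
have [/existsP[i /andP[]]|/existsPn noi] :=
  boolP [exists i, (i \notin J) && (0 < cf i a)]; first by exists i.
have cf0 i : i \notin J -> cf i a = 0.
  move=> iJ; have := noi i; rewrite iJ /= -leNgt => le0.
  by apply/eqP; rewrite eq_le le0 a_ge0.
have [j aj] : exists j, 0 < cf j a.
  apply/existsP; apply: contraT => /existsPn a0.
  case/eqP: (Phi_neq0 aPhi); rewrite (cfE a) big1 // => i _.
  have := a0 i; rewrite -leNgt => le0.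
  have -> : cf i a = 0 by apply/eqP; rewrite eq_le le0 a_ge0.
  by rewrite scale0r.
have jJ : j \in J by apply: contraTT aj => /cf0 ->; rewrite ltxx.
have [tW rt] := tP (al_Phi j).
have := Phi_stable tW aPhi; rewrite rt refl_mxE -/(refl_coef j a).
have -> : refl_coef j a = 2 * cf j a.
  rewrite /refl_coef [in dot _ a](cfE a).
  have -> : dot (al j) (\sum_i cf i a *: al i) = \sum_i cf i a * dot (al j) (al i).
    rewrite /dot mulmx_sumr summxE; apply: eq_bigr => i _.
    by rewrite -scalemxAr mxE.
  rewrite (bigD1 j) //= big1 ?addr0 => [|i ij].
    by rewrite mulrCA divfK 1?mulrC // gt_eqF // dot_gt0 // (Phi_neq0 (al_Phi j)).
  have [iJ|/cf0 ->] := boolP (i \in J); last by rewrite mul0r.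
  by rewrite orthJ ?mulr0 // eq_sym.
set b := _ - _ => bPhi.
have cfb i : cf i b = cf i a - 2 * cf j a * (j == i)%:R.
  by rewrite linearB linearZ /= cf_al.
have a_eq : a = cf j a *: al j.
  have [b_ge0|b_le0] := Phi_sign bPhi.
    have := b_ge0 j; rewrite cfb eqxx mulr1 mulr_natl mulr2n opprD addrA subrr.
    by rewrite sub0r oppr_ge0 leNgt aj.
  rewrite [LHS]cfE (bigD1 j) //= big1 ?addr0 // => i ij.
  have := b_le0 i; rewrite cfb eq_sym (negPf ij) mulr0 subr0 => le0.
  have -> : cf i a = 0 by apply/eqP; rewrite eq_le le0 a_ge0.
  by rewrite scale0r.
have [aj1|aj1] : cf j a = 1 \/ cf j a = -1.
- by apply: (Phi_reduced (al_Phi j)); rewrite -a_eq.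
- by case/negP: aJ; apply/imageP; exists j => //; rewrite a_eq aj1 scale1r.
- by move: aj; rewrite aj1 ltr0N1.
Qed.

Lemma positive_prod_refl a : positive D a -> a \notin [seq al i | i in J] ->
  positive D (rW (prod_refl J) *m a) /\
  rW (prod_refl J) *m a \notin [seq al i | i in J].
Proof.
move=> apos aJ; have [i iJ ai] := positive_cf_gt0 apos aJ.
have aPhi : a \in Phi D by case/andP: apos.
have ai' : 0 < cf i (rW (prod_refl J) *m a) by rewrite cf_prod_refl.
split.
  rewrite /positive prod_refl_Phi //=; apply/forallP.
  have [//|] := Phi_sign (prod_refl_Phi aPhi).
  by move/(_ i); rewrite leNgt ai'.
apply/imageP => -[j jJ eq_j]; move: ai'; rewrite eq_j cf_al.
by case: eqP => [ji|_]; rewrite ?ltxx //; rewrite -ji jJ in iJ.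
Qed.

End Orthogonal.

Lemma orth_black : {in black D &, forall i j, i != j -> dot (al i) (al j) = 0}.
Proof. by move=> i j iB jB /Pi_bipartite; apply; rewrite iB jB. Qed.

Lemma orth_white : {in ~: black D &, forall i j, i != j -> dot (al i) (al j) = 0}.
Proof.
move=> i j; rewrite !inE => iW jW /Pi_bipartite; apply.
by rewrite (negPf iW) (negPf jW).
Qed.

Lemma positive_PiN a : a \in Pi D -> positive D a /\ ~~ positive D (- a).
Proof.
case/tnthP => i ->; split.
  rewrite /positive al_Phi; apply/forallP => j; rewrite cf_al; exact: ler0n.
apply/negP => /andP[_ /forallP/(_ i)].
by rewrite linearN /= cf_al eqxx oppr_ge0 ler10.
Qed.

Lemma positiveN a : positive D a -> ~~ positive D (- a).
Proof.
case/andP=> aPhi /forallP a_ge0; apply/negP => /andP[_ /forallP Na_ge0].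
case/eqP: (Phi_neq0 aPhi); apply: cf_inj => i; rewrite linear0.
apply/eqP; rewrite eq_le a_ge0 andbT -oppr_ge0.
by have := Na_ge0 i; rewrite linearN.
Qed.

Lemma PiB_Pi : {subset PiB D <= Pi D}.
Proof. by move=> _ /imageP[i _ ->]; apply: mem_tnth. Qed.

Lemma PiW_Pi : {subset PiW D <= Pi D}.
Proof. by move=> _ /imageP[i _ ->]; apply: mem_tnth. Qed.

Lemma mem_Pi a : (a \in Pi D) = (a \in PiB D) || (a \in PiW D).
Proof.
apply/idP/idP => [/tnthP[i ->]|/orP[/PiB_Pi|/PiW_Pi] //].
have [iB|iW] := boolP (i \in black D); apply/orP; [left|right].
  by apply/imageP; exists i.
by apply/imageP; exists i; rewrite ?inE.
Qed.

Lemma PiBW a : a \in PiB D -> a \notin PiW D.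
Proof.
case/imageP=> i iB ->; apply/imageP => -[j + /al_inj eq_ij].
by rewrite inE -eq_ij iB.
Qed.

Lemma cB_PiB a : a \in PiB D -> rW (cB D) *m a = - a.
Proof. by case/imageP=> i iB ->; apply: prod_refl_al orth_black _ iB. Qed.

Lemma cW_PiW a : a \in PiW D -> rW (cW D) *m a = - a.
Proof. by case/imageP=> i iW ->; apply: prod_refl_al orth_white _ iW. Qed.

Lemma cBK : involutive (fun v : V => rW (cB D) *m v).
Proof. exact: prod_reflK orth_black. Qed.

Lemma cWK : involutive (fun v : V => rW (cW D) *m v).
Proof. exact: prod_reflK orth_white. Qed.

Lemma coxE v : rW (cox D) *m v = rW (cB D) *m (rW (cW D) *m v).
Proof. by rewrite mulmxA -repr_mxM //; apply: prod_refl_W. Qed.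

Lemma positive_cB a : positive D a -> a \notin PiB D ->
  positive D (rW (cB D) *m a) /\ rW (cB D) *m a \notin PiB D.
Proof. exact: positive_prod_refl orth_black _. Qed.

Lemma positive_cW a : positive D a -> a \notin PiW D ->
  positive D (rW (cW D) *m a) /\ rW (cW D) *m a \notin PiW D.
Proof. exact: positive_prod_refl orth_white _. Qed.

Section ColoredMaps.
Variables (m : nat) (m_gt0 : (0 < m)%N).

Variant colored_spec (a : V) (i : nat) : Prop :=
| ColoredPos of positive D a & ~~ (- a \in Pi D) & (0 < i <= m)%N
| ColoredNeg of ~~ positive D a & - a \in Pi D & i = 1%N.

Lemma colored_rootsP a i :
  reflect (colored_spec a i) ((a, i) \in colored_roots D m).
Proof.
rewrite mem_cat; apply: (iffP orP) => [[|]|[apos _ i_m|_ Na ->]].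
- case/allpairsP=> -[b j] /= [+ + [-> ->]].
  rewrite mem_filter mem_iota add1n ltnS => /andP[apos _] jm.
  apply: ColoredPos => //; apply/negP => /positive_PiN[].
  by rewrite (negPf (positiveN apos)).
- case/mapP=> b bPi [-> ->]; have [_ nb] := positive_PiN bPi.
  by apply: ColoredNeg; rewrite ?opprK.
- left; apply/allpairsP; exists (a, i); split=> //=.
    by rewrite mem_filter apos; case/andP: apos.
  by rewrite mem_iota add1n ltnS.
- by right; apply/mapP; exists (- a); rewrite ?opprK.
Qed.

Lemma colored_pos a i :
  positive D a -> (0 < i <= m)%N -> (a, i) \in colored_roots D m.
Proof.
move=> apos im; apply/colored_rootsP/ColoredPos => //.
by apply/negP => /positive_PiN[]; rewrite (negPf (positiveN apos)).
Qed.

Lemma colored_neg a : a \in Pi D -> (- a, 1%N) \in colored_roots D m.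
Proof.
move=> aPi; apply/colored_rootsP/ColoredNeg; rewrite ?opprK //.
by case: (positive_PiN aPi).
Qed.

(* cox maps a positive root outside \Pi_\circ, or the opposite of a root in    *)
(* \Pi_\circ, to an almost positive root outside \Pi_\bullet and - \Pi_\circ.   *)
Lemma cox_colored a : (positive D a && (a \notin PiW D)) || (- a \in PiW D) ->
  [/\ (rW (cox D) *m a, 1%N) \in colored_roots D m,
      rW (cox D) *m a \notin PiB D & - (rW (cox D) *m a) \notin PiW D].
Proof.
move=> ha; rewrite coxE; set b := rW (cW D) *m a.
have bpos : positive D b.
  case/orP: ha => [/andP[apos aW]|NaW]; first by case: (positive_cW apos aW).
  rewrite /b -[a]opprK mulmxN cW_PiW // opprK.
  by case: (positive_PiN (PiW_Pi NaW)).
split.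
- have [bB|bB] := boolP (b \in PiB D).
    by rewrite cB_PiB //; apply/colored_neg/PiB_Pi.
  by apply: colored_pos; rewrite ?m_gt0 //; case: (positive_cB bpos bB).
- apply/negP => /[dup] /cB_PiB; rewrite cBK => bE /PiB_Pi/positive_PiN[_].
  by rewrite -bE bpos.
apply/negP => cbW.
have Ncpos := (positive_PiN (PiW_Pi cbW)).1.
have NcB : - (rW (cB D) *m b) \notin PiB D by apply: contraL cbW; apply: PiBW.
have [+ _] := positive_cB Ncpos NcB.
by rewrite mulmxN cBK (negPf (positiveN bpos)).
Qed.

Variant Rraw_spec (a : V) (i : nat) : V * nat -> Prop :=
| RrawShift of positive D a & (0 < i < m)%N : Rraw_spec a i (a, i.+1)
| RrawWhite of a \in PiW D & i = m : Rraw_spec a i (- a, 1%N)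
| RrawBlack of - a \in PiB D & i = 1%N : Rraw_spec a i (- a, 1%N)
| RrawCoxPos of positive D a & a \notin PiW D & i = m :
    Rraw_spec a i (rW (cox D) *m a, 1%N)
| RrawCoxNeg of - a \in PiW D & i = 1%N :
    Rraw_spec a i (rW (cox D) *m a, 1%N).

Lemma RrawP a i : (a, i) \in colored_roots D m -> Rraw_spec a i (Rraw D m (a, i)).
Proof.
case/colored_rootsP => [apos Na /andP[i_gt0 le_im]|/negPf npos Na ->]; rewrite /Rraw.
  have NaB : (- a \in PiB D) = false.
    by apply: contraNF Na => /PiB_Pi.
  rewrite apos NaB /= orbF; case: ltnP => [lt_im|le_mi].
    by apply: RrawShift; rewrite ?i_gt0.
  have -> : i = m by apply/eqP; rewrite eqn_leq le_im.
  by rewrite eqxx andbT; case: ifP => [|/negbT]; constructor.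
rewrite npos /= andbT.
have aW : (a \in PiW D) = false.
  by apply: contraFF npos => /PiW_Pi/positive_PiN[].
rewrite aW /=; move: Na; rewrite mem_Pi.
by case: ifP => [NaB _|_ NaW]; constructor.
Qed.

Lemma Rraw_colored x : x \in colored_roots D m -> Rraw D m x \in colored_roots D m.
Proof.
case: x => a i /RrawP[] //.
- by move=> apos /andP[_ lt_im]; apply: colored_pos.
- by move=> aW _; apply/colored_neg/PiW_Pi.
- by move=> aB _; apply: colored_pos => //; case: (positive_PiN (PiB_Pi aB)).
- by move=> apos aW _; case: (@cox_colored a); rewrite // apos aW.
- by move=> aW _; case: (@cox_colored a); rewrite // aW orbT.
Qed.

Lemma cox_inj (u v : V) : rW (cox D) *m u = rW (cox D) *m v -> u = v.
Proof. by rewrite !coxE => /(can_inj cBK)/(can_inj cWK). Qed.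

Lemma Rraw_inj : {in colored_roots D m &, injective (Rraw D m)}.
Proof.
have noB a b : (positive D b && (b \notin PiW D)) || (- b \in PiW D) ->
    - a = rW (cox D) *m b -> - a \in PiB D -> False.
  by case/cox_colored=> _ /negP bB _ ->.
have noW a b : (positive D b && (b \notin PiW D)) || (- b \in PiW D) ->
    - a = rW (cox D) *m b -> a \in PiW D -> False.
  by case/cox_colored=> _ _ /negP bW aE aW; apply: bW; rewrite -aE opprK.
have BW a b : - a \in PiB D -> b \in PiW D -> - a = - b -> False.
  move=> /PiB_Pi/positive_PiN[apos _] /PiW_Pi/positive_PiN[bpos _] ab.
  by have := positiveN bpos; rewrite -ab apos.
have posW a : positive D a -> - a \in PiW D -> False.
  by move=> apos /PiW_Pi/positive_PiN[_]; rewrite opprK apos.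
have cond1 a : positive D a -> a \notin PiW D ->
  (positive D a && (a \notin PiW D)) || (- a \in PiW D) by move=> -> ->.
have cond2 a : - a \in PiW D ->
  (positive D a && (a \notin PiW D)) || (- a \in PiW D) by move=> ->; rewrite orbT.
case=> a i [b j] /RrawP ha /RrawP hb.
case: ha => [ap ai|aW ai|aB ai|ap aW ai|aW ai];
  case: hb => [bp bj|bW bj|bB bj|bp bW bj|bW bj] [] eq_ab //;
  try by move=> eq_ij; subst.
- by move: eq_ab => /oppr_inj->; subst.
- by case: (BW b a bB aW).
- by case: (noW a b (cond1 b bp bW) eq_ab aW).
- by case: (noW a b (cond2 b bW) eq_ab aW).
- by case: (BW a b aB bW).
- by move: eq_ab => /oppr_inj->; subst.
- by case: (noB a b (cond1 b bp bW) eq_ab aB).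
- by case: (noB a b (cond2 b bW) eq_ab aB).
- by case: (noW b a (cond1 a ap aW) (esym eq_ab) bW).
- by case: (noB b a (cond1 a ap aW) (esym eq_ab) bB).
- by move: eq_ab => /cox_inj->; subst.
- by case: (posW b); rewrite // -(cox_inj eq_ab).
- by case: (noW b a (cond2 a aW) (esym eq_ab) bW).
- by case: (noB b a (cond2 a aW) (esym eq_ab) bB).
- by case: (posW a); rewrite // (cox_inj eq_ab).
- by move: eq_ab => /cox_inj->; subst.
Qed.

Lemma positive_notin a : positive D a -> (- a \in PiW D = false) * (- a \in PiB D = false).
Proof.
move=> apos; have Na : - a \notin Pi D.
  by apply/negP => /positive_PiN[]; rewrite (negPf (positiveN apos)).
by split; apply: contraNF Na; [apply: PiW_Pi | apply: PiB_Pi].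
Qed.

Lemma Sraw_colored x : x \in colored_roots D m ->
  Sraw D m x \in colored_roots D m /\ Sraw D m (Sraw D m x) = x.
Proof.
case: x => a i /colored_rootsP[apos Na /andP[i_gt0 le_im]|npos Na ->].
  have [NaW NaB] := positive_notin apos.
  rewrite /Sraw NaW NaB /=; case: ifP => [aB|/negbT aB].
    case: eqP => [->|/eqP i_m].
      rewrite opprK (negPf (PiBW aB)) aB /=; split=> //.
      exact/colored_neg/PiB_Pi.
    have lt_im : (i < m)%N by rewrite ltn_neqAle i_m.
    rewrite NaW NaB aB /= ltn_eqF ?subKn ?ltn_subrL ?i_gt0 //; split=> //.
    by apply: colored_pos; rewrite // subn_gt0 lt_im leq_subr.
  have [bpos bB] := positive_cB apos aB.
  have [NbW NbB] := positive_notin bpos.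
  rewrite NbW NbB (negPf bB) /= cBK subKn ?(leq_trans le_im) //; split=> //.
  apply: colored_pos => //.
  by rewrite subn_gt0 ltnS le_im leq_subLR addnC -addn1 leq_add2l.
rewrite /Sraw eqxx !andbT; move: Na; rewrite mem_Pi.
have [NaW _|_] := boolP (- a \in PiW D).
  by rewrite NaW; split=> //; rewrite -[a]opprK; apply/colored_neg/PiW_Pi.
rewrite orbF => NaB; rewrite NaB.
have Napos := (positive_PiN (PiB_Pi NaB)).1.
have [-> ->] := positive_notin Napos.
rewrite NaB eqxx opprK; split=> //.
by apply: colored_pos; rewrite // m_gt0 leqnn.
Qed.

Definition Rfun (x : croot D m) : croot D m := SeqSub (Rraw_colored (ssvalP x)).
Definition Sfun (x : croot D m) : croot D m := SeqSub (Sraw_colored (ssvalP x)).1.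

Lemma Rfun_inj : injective Rfun.
Proof.
move=> x y [eq_xy]; apply: val_inj.
exact: Rraw_inj (ssvalP x) (ssvalP y) eq_xy.
Qed.

Lemma Sfun_inj : injective Sfun.
Proof.
apply: (can_inj (g := Sfun)) => x; apply: val_inj.
exact: (Sraw_colored (ssvalP x)).2.
Qed.

Definition Rperm : {perm croot D m} := perm Rfun_inj.
Definition Sperm : {perm croot D m} := perm Sfun_inj.

Definition dihedral : {group {perm croot D m}} := <<[set Rperm; Sperm]>>%G.

End ColoredMaps.
End Permutations.
End ReflectionGroup.

(* Main.v *)
Require Import Defs.
From HB Require Import structures.
From mathcomp Require Import classical_sets topology normedtype derive.
From mathcomp Require Import all_boot all_order all_algebra all_fingroup all_character.
From mathcomp Require Import boolp reals.
From mathcomp Require Import cyclic.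
From mathcomp Require Import zify ring lra.

(** Write [f] for a face, [u = (prod f)^-1 c] for its coface and [h] for the
    order of [c].  The rotation moves every block of colored roots by [- h]
    modulo [m h + 2], acting on the reflections by the identity on the blocks
    of index at least [h] and by conjugation by [c] on the others.  If
    [prod f = A B], where [B] collects the blocks of index less than [h], the
    rotated face has product [c B c^-1 A] and hence coface [B u B^-1].
    Similarly the reflection fixes block [0] and sends block [k] to block
    [m h + 2 - k], acting by conjugation by [c_b] (the product of the black
    simple reflections); since the product of a block is an involution and
    the white reflections of block [0] commute with [c_w], the new coface is a
    conjugate of [u^-1].  Being a face only depends on lengths: the product of
    the image has length at most the number of its elements, the length of the
    coface does not change, and subadditivity of the length gives the converse
    bound.  So the theorem follows from two facts.

    The first is that blocks really move in this way ([Rraw_block],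
    [Sraw_block]), which is Steinberg's description of the layers
    [Pi_layer k] ([steinberg]): those of index [1..h] are disjoint and
    positive, layer [h] consists of the white simple roots, and layer [k + h]
    is the opposite of layer [k].  The Gram matrix of the simple roots has
    nonpositive off-diagonal entries and, by irreducibility, is not block
    diagonal; so it has a positive Perron vector ([perron_simple], obtained by
    minimizing a quadratic form on a compact ellipsoid).  This vector yields a
    plane of linear forms stable under [c_b] and [c_w], on which a form takes
    the values [a u_k + b u_(k-1)] on layer [k], up to positive factors
    depending only on the simple root that is transported.  Here [u] is the
    Chebyshev recurrence [cheb], and everything is read off from its first
    positive zero [N].  In particular [c ^+ N] permutes the simple roots, so
    that it is the identity by the exchange condition ([word_eq1]); hence
    [h = N].

    The second is that every [u <= c] is conjugate to its inverse ([NC_inv]).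
    More precisely [u] is conjugate to the bipartite Coxeter element [c_J] of
    a standard parabolic subgroup ([sub_cox_conj]), and such elements are
    inverted by their black part.  Indeed, if [c_J = u y t] with a
    factorization of minimal length ending with a reflection [t], then the
    root of [t] lies in the span of the simple roots of [J] because this span
    is the moved space of [c_J] ([shortest_factor_in_span]); and any root in
    this span has a simple root or its opposite in its orbit under [c_J],
    since otherwise the sum of its orbit would be a nonzero fixed vector
    ([sub_cox_orbit]).  So up to conjugation [t] is a simple reflection and
    can be cancelled from [c_J], which leaves a smaller [J]. *)

Set Implicit Arguments.
Unset Strict Implicit.
Unset Printing Implicit Defensive.

Import Order.TTheory GRing.Theory Num.Theory GroupScope.
Local Open Scope ring_scope.

(** * Perron vectors *)

Section Perron.
Import numFieldNormedType.Exports.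
Local Open Scope classical_set_scope.
Variables (R : realType) (n : nat).

Lemma continuous_fsum (T : topologicalType) (I : Type) (s : seq I)
    (F : I -> T -> R) :
  (forall i, continuous (F i)) -> continuous (fun x => \sum_(i <- s) F i x).
Proof.
move=> cF; elim: s => [|i s IHs] x.
  by under eq_fun do rewrite big_nil; apply: cst_continuous.
under eq_fun do rewrite big_cons.
by apply: continuousD; [exact: cF | exact: IHs].
Qed.

(** First-order condition at a minimum: a nonnegative quadratic function
    vanishing at [0] has no linear term. *)
Lemma quadratic_ge0_linear0 (b c : R) :
  (forall e, 0 <= e * b + e ^+ 2 * c) -> b = 0.
Proof.
move=> h; apply/eqP/contraT => b0.
have b2 : 0 < b ^+ 2 by rewrite exprn_even_gt0.
have k0 : 0 < `|c| + 1 by rewrite ltr_wpDl.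
(* At this point the linear term dominates the quadratic one. *)
have := h (- (b / (`|c| + 1))).
have -> : - (b / (`|c| + 1)) * b + (- (b / (`|c| + 1))) ^+ 2 * c
          = - (b / (`|c| + 1)) ^+ 2 * (`|c| + 1 - c).
  by field; rewrite gt_eqF.
rewrite mulNr oppr_ge0 => le0.
have : 0 < (b / (`|c| + 1)) ^+ 2 * (`|c| + 1 - c).
  apply: mulr_gt0; first by rewrite exprn_even_gt0 //= mulf_neq0 // invr_neq0 // gt_eqF.
  by have := ler_norm c; lra.
lra.
Qed.

Variable g : 'I_n -> 'I_n -> R.
Hypotheses (n_gt0 : (0 < n)%N) (g_sym : forall i j, g i j = g j i)
  (g_diag : forall i, 0 < g i i) (g_off : forall i j, i != j -> g i j <= 0).

Let q (v : 'rV[R]_n) := \sum_i \sum_j g i j * (v 0 i * v 0 j).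
Let N (v : 'rV[R]_n) := \sum_i g i i * (v 0 i) ^+ 2.

Let cont_term i j : continuous (fun v : 'rV[R]_n => g i j * (v 0 i * v 0 j)).
Proof.
move=> v; have ci k : {for v, continuous (fun x : 'rV[R]_n => x 0 k)}.
  exact: coord_continuous.
have cg : {for v, continuous (fun x : 'rV[R]_n => g i j)}.
  exact: cst_continuous.
have cij := continuousM (ci i) (ci j).
exact: (continuousM cg cij).
Qed.

Let cont_q : continuous q.
Proof. by apply: continuous_fsum => i; apply: continuous_fsum => j. Qed.

Let cont_N : continuous N.
Proof. by apply: continuous_fsum => i; apply: cont_term. Qed.

Let N_ge0 (v : 'rV[R]_n) : 0 <= N v.
Proof. by apply: sumr_ge0 => i _; rewrite mulr_ge0 ?sqr_ge0 // ltW. Qed.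

Let N_term (v : 'rV[R]_n) i : g i i * (v 0 i) ^+ 2 <= N v.
Proof.
rewrite /N (bigD1 i) //= lerDl sumr_ge0 // => j _.
by rewrite mulr_ge0 ?sqr_ge0 // ltW.
Qed.

Let qZ a (v : 'rV[R]_n) : q (a *: v) = a ^+ 2 * q v.
Proof.
rewrite /q mulr_sumr; apply: eq_bigr => i _; rewrite mulr_sumr.
by apply: eq_bigr => j _; rewrite !mxE; ring.
Qed.

Let NZ a (v : 'rV[R]_n) : N (a *: v) = a ^+ 2 * N v.
Proof. by rewrite /N mulr_sumr; apply: eq_bigr => i _; rewrite !mxE; ring. Qed.

Let compactN : compact [set v : 'rV[R]_n | N v = 1].
Proof.
apply: bounded_closed_compact.
  exists (\sum_i ((g i i)^-1 + 1)); split; first exact: num_real.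
  move=> M ltM v /= Nv.
  have Mge0 : 0 <= M.
    by apply: ltW (le_lt_trans _ ltM); apply: sumr_ge0 => i _; rewrite addr_ge0 // invr_ge0 ltW.
  rewrite [leLHS]/Num.norm /= mx_normrE; apply: bigmax_le => // -[i' i] _ /=.
  rewrite ord1 {i'}; apply: (le_trans _ (ltW ltM)).
  apply: (@le_trans _ _ ((g i i)^-1 + 1)); last first.
    rewrite (bigD1 i) //= lerDl sumr_ge0 // => j _.
    by rewrite addr_ge0 // invr_ge0 ltW.
  have gi : 0 < (g i i)^-1 by rewrite invr_gt0.
  have : `|v 0 i| ^+ 2 <= (g i i)^-1.
    rewrite real_normK ?num_real // -[leRHS]mulr1 ler_pdivlMl //.
    by rewrite -Nv.
  by have := normr_ge0 (v 0 i); nra.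
have -> : [set v : 'rV[R]_n | N v = 1] = N @^-1` [set x | x = 1] by [].
by apply: preimage_closed; [move=> v _; apply: cont_N | apply: closed_eq].
Qed.

(** A minimizer of the quadratic form [q] on the ellipsoid [N v = 1] is an
    eigenvector, and replacing its entries by their absolute values can only
    decrease [q], because the off-diagonal entries of [g] are nonpositive. *)
Lemma perron_vector : exists (y : 'I_n -> R) (l : R),
  [/\ forall i, 0 <= y i, exists i, 0 < y i &
      forall i, \sum_j g i j * y j = l * (g i i * y i)].
Proof.
have [i0 _] : exists i : 'I_n, true by exists (Ordinal n_gt0).
have ne : [set v : 'rV[R]_n | N v = 1] !=set0.
  exists ((Num.sqrt (g i0 i0))^-1 *: delta_mx 0 i0).
  rewrite /= NZ exprVn sqr_sqrtr ?ltW // /N (bigD1 i0) //= big1 => [|j ji].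
    by rewrite mxE !eqxx expr1n mulr1 addr0 mulVf // gt_eqF.
  by rewrite mxE (negPf ji) andbF expr0n mulr0.
have cq : {within [set v : 'rV[R]_n | N v = 1], continuous q}.
  by apply: continuous_subspaceT; apply: cont_q.
have [y0 + ymin] := EVT_min_rV ne compactN cq.
rewrite classical_sets.inE /= => Ny0.
(* By homogeneity [F] is nonnegative everywhere; it vanishes at [y0] and [y]. *)
pose F (v : 'rV[R]_n) := q v - q y0 * N v.
have F_ge0 (v : 'rV[R]_n) : 0 <= F v.
  rewrite /F; have [Nv0|Nv0] := eqVneq (N v) 0.
    have -> : v = 0.
      apply/rowP => i; rewrite mxE; apply/eqP; rewrite -sqrf_eq0.
      have := N_term v i; rewrite Nv0 => le0.
      rewrite eq_le sqr_ge0 andbT -(pmulr_rle0 _ (g_diag i)) //.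
    rewrite -(scale0r (0 : 'rV_n)) qZ NZ expr0n /= !mul0r mulr0 subrr //.
  have Nv : 0 < N v by rewrite lt_def Nv0 N_ge0.
  have := ymin ((Num.sqrt (N v))^-1 *: v).
  rewrite classical_sets.inE /= NZ qZ exprVn (sqr_sqrtr (ltW Nv)) mulVf // => /(_ erefl).
  by rewrite ler_pdivlMl // subr_ge0 mulrC.
pose y : 'rV[R]_n := \row_i `|y0 0 i|.
have Ny : N y = 1.
  by rewrite -Ny0; apply: eq_bigr => i _; rewrite mxE real_normK ?num_real.
have Fy : F y = 0.
  apply/eqP; rewrite eq_le F_ge0 andbT /F Ny mulr1 subr_le0.
  apply: ler_sum => i _; apply: ler_sum => j _; rewrite !mxE -normrM.
  have [->|ij] := eqVneq i j; first by rewrite ger0_norm // -expr2 sqr_ge0.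
  by apply: ler_wnM2l; [apply: g_off | apply: ler_norm].
exists (fun i => y 0 i), (q y0); split.
- by move=> i; rewrite mxE.
- apply/existsP; apply: contraT => /existsPn y_le0.
  have : N y = 0.
    apply: big1 => i _; have := y_le0 i.
    rewrite lt_def mxE normr_ge0 andbT negbK => /eqP ->.
    by rewrite expr0n mulr0.
  by rewrite Ny => /eqP; rewrite oner_eq0.
move=> i; apply/eqP; rewrite -subr_eq0; apply/eqP.
set b := _ - _.
suff : 2 * b = 0 by move/eqP; rewrite mulf_eq0 pnatr_eq0 /= => /eqP.
apply: (@quadratic_ge0_linear0 _ (F (delta_mx 0 i))) => e.
suff <- : F (y + e *: delta_mx 0 i) = e * (2 * b) + e ^+ 2 * F (delta_mx 0 i).
  exact: F_ge0.
rewrite -[RHS]add0r -Fy /F.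
have d k : (delta_mx 0 i : 'rV[R]_n) 0 k = (k == i)%:R by rewrite mxE eqxx.
have pick (f : 'I_n -> R) : \sum_k (k == i)%:R * f k = f i.
  rewrite (bigD1 i) //= eqxx mul1r big1 ?addr0 // => k /negPf ->.
  by rewrite mul0r.
have qE : q (y + e *: delta_mx 0 i)
          = q y + e * (2 * \sum_j g i j * y 0 j) + e ^+ 2 * q (delta_mx 0 i).
  have -> : q (y + e *: delta_mx 0 i) =
     \sum_k \sum_j (g k j * (y 0 k * y 0 j) + e * ((k == i)%:R * (g k j * y 0 j))
        + e * ((j == i)%:R * (g j k * y 0 k)) + e ^+ 2 * (g k j * ((k == i)%:R * (j == i)%:R))).
    apply: eq_bigr => k _; apply: eq_bigr => j _.
    by rewrite !mxE !eqxx /= (g_sym k j); ring.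
  under eq_bigr do rewrite !big_split /= -!mulr_sumr pick.
  rewrite !big_split /= -!mulr_sumr pick /q.
  congr (_ + _).
    by rewrite -addrA; congr (_ + _); ring.
  congr (_ * _); apply: eq_bigr => k _; apply: eq_bigr => j _; rewrite !d //.
have NE : N (y + e *: delta_mx 0 i)
          = N y + e * (2 * (g i i * y 0 i)) + e ^+ 2 * N (delta_mx 0 i).
  have -> : N (y + e *: delta_mx 0 i) =
     \sum_k (g k k * y 0 k ^+ 2 + e * (2 * ((k == i)%:R * (g k k * y 0 k)))
        + e ^+ 2 * (g k k * (k == i)%:R ^+ 2)).
    by apply: eq_bigr => k _; rewrite !mxE !eqxx /=; ring.
  rewrite !big_split /= -!mulr_sumr pick.
  congr (_ + _ + _); congr (_ * _).
  by apply: eq_bigr => k _; rewrite d.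
rewrite qE NE /b; ring.
Qed.

End Perron.

(** * Reflections, absolute length and the exchange condition *)

Section Dot.
Variables (R : realType) (n : nat).
Implicit Types u v w : 'cV[R]_n.

Lemma dotC u v : dot u v = dot v u.
Proof. by rewrite /dot -[v^T *m u]trmxK trmx_mul trmxK [RHS]mxE. Qed.

Lemma dotDr u v w : dot u (v + w) = dot u v + dot u w.
Proof. by rewrite /dot mulmxDr mxE. Qed.

Lemma dotZr k u v : dot u (k *: v) = k * dot u v.
Proof. by rewrite /dot -scalemxAr mxE. Qed.

Lemma dotNr u v : dot u (- v) = - dot u v.
Proof. by rewrite -scaleN1r dotZr mulN1r. Qed.

Lemma dot0r u : dot u 0 = 0.
Proof. by rewrite -(scale0r u) dotZr mul0r. Qed.

Lemma dot_sumr (I : Type) (s : seq I) (P : pred I) u (F : I -> 'cV[R]_n) :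
  dot u (\sum_(i <- s | P i) F i) = \sum_(i <- s | P i) dot u (F i).
Proof. by rewrite /dot mulmx_sumr summxE. Qed.

Lemma dot_eq0 u : (dot u u == 0) = (u == 0).
Proof.
have [->|u0] := eqVneq u 0; first by rewrite dot0r eqxx.
by rewrite gt_eqF // dot_gt0.
Qed.

Lemma refl_mxN u : refl_mx (- u) = refl_mx u.
Proof.
by rewrite /refl_mx dotNr dotC dotNr opprK [(- u)^T]linearN mulNmx mulmxN opprK.
Qed.

Lemma refl_mx_self u : u != 0 -> refl_mx u *m u = - u.
Proof.
move=> u0; rewrite refl_mxE divfK ?gt_eqF ?dot_gt0 //.
by rewrite scaler_nat mulr2n opprD addrA subrr sub0r.
Qed.

Lemma refl_mx_tr u : (refl_mx u)^T = refl_mx u.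
Proof. by rewrite /refl_mx linearB /= trmx1 [(_ *: _)^T]linearZ /= trmx_mul trmxK. Qed.

Lemma refl_mx_sqr u : u != 0 -> refl_mx u *m refl_mx u = 1%:M.
Proof.
move=> u0; rewrite [X in X *m _]/refl_mx mulmxBl mul1mx -scalemxAl -mulmxA.
have -> : u^T *m refl_mx u = (refl_mx u *m u)^T.
  by rewrite trmx_mul refl_mx_tr.
rewrite refl_mx_self // [(- u)^T]linearN /= mulmxN scalerN opprK.
by rewrite /refl_mx subrK.
Qed.

Lemma refl_mx_conj (A : 'M[R]_n) u : A^T *m A = 1%:M ->
  A *m refl_mx u *m A^T = refl_mx (A *m u).
Proof.
move=> AtA; have AAt : A *m A^T = 1%:M by apply: mulmx1C.
rewrite {1}/refl_mx mulmxBr mulmx1 mulmxBl AAt -scalemxAr -scalemxAl /refl_mx.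
have -> : dot (A *m u) (A *m u) = dot u u.
  by rewrite /dot trmx_mul -mulmxA [A^T *m _]mulmxA AtA mul1mx.
by rewrite trmx_mul !mulmxA.
Qed.

Lemma refl_mx_orth u v : dot u v = 0 -> refl_mx u *m v = v.
Proof. by move=> uv; rewrite refl_mxE uv mulr0 scale0r subr0. Qed.

End Dot.

Section Length.
Variables (R : realType) (n : nat) (gT : finGroupType) (W : {group gT}).
Variable rW : mx_representation R W n.
Hypothesis orthW : {in W, forall w, (rW w)^T *m rW w = 1%:M}.
Local Notation T := (reflections rW).
Local Notation len := (abs_length rW).

Lemma repr_inv_tr g : g \in W -> rW g^-1%g = (rW g)^T.
Proof.
move=> gW; rewrite repr_mxV //.
apply: (can_inj (mulKmx (repr_mx_unit rW gW))).
by rewrite mulmxV ?repr_mx_unit // (mulmx1C (orthW gW)).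
Qed.

Local Open Scope group_scope.

Lemma reflectionsJ x g : x \in T -> g \in W -> x ^ g \in T.
Proof.
rewrite !inE => /andP[xW /asboolP[a [a0 rx]]] gW; rewrite groupJ //=.
have giW : g^-1 \in W by rewrite groupV.
apply/asboolP; exists (rW g^-1%g *m a)%R; split.
  apply: contra_neq a0 => /(congr1 (mulmx (rW g))).
  by rewrite mulmxA -repr_mxM // mulgV repr_mx1 mul1mx mulmx0.
rewrite -refl_mx_conj; last exact: orthW.
by rewrite -rx /conjg repr_mxM ?groupM // repr_mxM // !repr_inv_tr // trmxK mulmxA.
Qed.

Lemma mem_expg_conj k x g : x \in T ^+ k -> g \in W -> x ^ g \in T ^+ k.
Proof.
elim: k x => [|k IHk] x; first by rewrite !expg0 => /set1P -> _; rewrite conj1g set11.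
rewrite !expgS => /mulsgP[y z yT zT ->] gW; rewrite conjMg.
by apply: mem_mulg; [apply: reflectionsJ | apply: IHk].
Qed.

(** The bound also holds when [k] exceeds the range of the search defining
    the length: the length never exceeds the order of the group. *)
Lemma len_le k x : x \in T ^+ k -> (len x <= k)%N.
Proof.
move=> xk; rewrite leqNgt; apply/negP => lt_k.
have := before_find 0%N lt_k.
have k_lt : (k < #|W|)%N.
  by apply: leq_trans lt_k _; rewrite -[leqRHS](size_iota 0); apply: find_size.
by rewrite nth_iota // add0n xk.
Qed.

Lemma len_max x : (len x <= #|W|)%N.
Proof. by rewrite -[leqRHS](size_iota 0); apply: find_size. Qed.

Lemma mem_len x : (len x < #|W|)%N -> x \in T ^+ len x.
Proof.
move=> lt_x; have := lt_x; rewrite -[X in (_ < X)%N](size_iota 0) -has_find.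
by move/(nth_find 0%N); rewrite nth_iota ?add0n.
Qed.

Lemma len_mul x y : (len (x * y) <= len x + len y)%N.
Proof.
have [xm|/mem_len xT] := leqP #|W| (len x).
  by apply: leq_trans (len_max _) (leq_trans xm _); apply: leq_addr.
have [ym|/mem_len yT] := leqP #|W| (len y).
  by apply: leq_trans (len_max _) (leq_trans ym _); apply: leq_addl.
by apply: len_le; rewrite expgD; apply: mem_mulg.
Qed.

Lemma len_conj x g : g \in W -> len (x ^ g) = len x.
Proof.
have le y h : h \in W -> (len (y ^ h) <= len y)%N.
  move=> hW; have [ym|/mem_len yT] := leqP #|W| (len y).
    exact: leq_trans (len_max _) ym.
  by apply: len_le; apply: mem_expg_conj.
move=> gW; apply/eqP; rewrite eqn_leq le //= -[leqLHS](congr1 len (conjgK g x)).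
by apply: le; rewrite groupV.
Qed.

Lemma len_eq0 x : len x = 0%N -> x = 1.
Proof.
move=> x0; have := @mem_len x; rewrite x0 => /(_ (cardG_gt0 W)).
by rewrite expg0 => /set1P.
Qed.

End Length.

Section Roots.
Variables (R : realType) (n : nat) (gT : finGroupType) (W : {group gT}).
Variables (rW : mx_representation R W n) (D : root_data rW).
Hypothesis hW : irreducible_reflection_group rW.
Local Notation al := (tnth (Pi D)).
Local Notation cf := (coord (Pi D)).
Local Notation t := (t rW).
Local Notation T := (reflections rW).
Let orthW := rg_orthogonal hW.

Lemma rW_inj : {in W &, injective rW}.
Proof. exact: mx_faithful_inj (rg_faithful hW). Qed.

Lemma reprM x y (v : 'cV[R]_n) : x \in W -> y \in W -> rW (x * y)%g *m v = rW x *m (rW y *m v).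
Proof. by move=> xW yW; rewrite repr_mxM // mulmxA. Qed.

Lemma repr_invK x (v : 'cV[R]_n) : x \in W -> rW x^-1%g *m (rW x *m v) = v.
Proof. by move=> xW; rewrite -reprM ?groupV // mulVg repr_mx1 mul1mx. Qed.

Lemma repr_invKV x (v : 'cV[R]_n) : x \in W -> rW x *m (rW x^-1%g *m v) = v.
Proof. by move=> xW; rewrite -reprM ?groupV // mulgV repr_mx1 mul1mx. Qed.

Lemma tW a : a \in Phi D -> t a \in W.
Proof. by case/tP. Qed.

Lemma tN a : t (- a) = t a.
Proof. by rewrite /Defs.t refl_mxN. Qed.

Lemma t_neg a : a \in Phi D -> rW (t a) *m a = - a.
Proof. by move=> aP; have [_ ->] := tP aP; rewrite refl_mx_self // (Phi_neq0 aP). Qed.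

Lemma t_orth a v : a \in Phi D -> dot a v = 0 -> rW (t a) *m v = v.
Proof. by move=> aP av; have [_ ->] := tP aP; apply: refl_mx_orth. Qed.

Lemma PhiN a : a \in Phi D -> - a \in Phi D.
Proof. by move=> aP; rewrite -t_neg //; apply: Phi_stable => //; apply: tW. Qed.

Lemma PhiNE a : (- a \in Phi D) = (a \in Phi D).
Proof. by apply/idP/idP => /PhiN //; rewrite opprK. Qed.

Lemma t_reflection a : a \in Phi D -> t a \in T.
Proof.
move=> aP; have [tW ta] := tP aP.
by rewrite inE tW; apply/asboolP; exists a; split; [apply: (Phi_neq0 aP)|].
Qed.

(** Faithfulness turns the corresponding identity of matrices into one in
    the group. *)
Lemma tJ a w : a \in Phi D -> w \in W -> t (rW w *m a) = (t a ^ w^-1)%g.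
Proof.
move=> aP wW; have waP : rW w *m a \in Phi D by apply: Phi_stable.
have [tW ta] := tP aP; have [twW twa] := tP waP.
apply: rW_inj; rewrite ?groupJ ?groupV //.
have wVW : (w^-1 \in W)%g by rewrite groupV.
rewrite twa conjgE invgK (repr_mxM rW wW (groupM tW wVW)) (repr_mxM rW tW wVW) ta.
by rewrite mulmxA (repr_inv_tr orthW wW) refl_mx_conj // orthW.
Qed.

Lemma t_sqr a : a \in Phi D -> (t a * t a = 1)%g.
Proof.
move=> aP; have [tW ta] := tP aP; apply: rW_inj; rewrite ?groupM //.
by rewrite repr_mxM // ta repr_mx1 refl_mx_sqr // (Phi_neq0 aP).
Qed.

Lemma tV a : a \in Phi D -> ((t a)^-1 = t a)%g.
Proof. by move=> aP; rewrite -[LHS]mulg1 -(t_sqr aP) mulKg. Qed.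

Lemma t_commute a b : a \in Phi D -> b \in Phi D -> dot a b = 0 ->
  commute (t a) (t b).
Proof.
move=> aP bP ab; apply/commgP/conjg_fixP.
by rewrite -[X in (_ ^ X)%g](tV bP) -(tJ aP (tW bP)) t_orth // dotC.
Qed.

Lemma root_sign a : a \in Phi D -> positive D a \/ positive D (- a).
Proof.
move=> aP; have [h|h] := Phi_sign aP; [left|right]; rewrite /positive ?PhiN ?aP //.
  by apply/forallP.
by apply/forallP => i; rewrite linearN /= oppr_ge0.
Qed.

Lemma positive_al i : positive D (al i).
Proof. by have [] := positive_PiN (mem_tnth i (Pi D)). Qed.

Lemma prod_refl1 i : prod_refl D [set i] = t (al i).
Proof. exact: big_set1. Qed.

Lemma positive_t i a : positive D a -> a != al i -> positive D (rW (t (al i)) *m a).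
Proof.
move=> apos ai; rewrite -prod_refl1.
have h : {in [set i] &, forall j k, j != k -> dot (al j) (al k) = 0}.
  by move=> j k /set1P -> /set1P ->; rewrite eqxx.
apply: (positive_prod_refl h apos _).1; apply/imageP => -[j /set1P -> aj].
by rewrite aj eqxx in ai.
Qed.

Definition word (s : seq 'I_n) : gT := (\prod_(i <- s) t (al i))%g.

Lemma wordW s : word s \in W.
Proof. by apply: group_prod => i _; apply: tW; apply: al_Phi. Qed.

(** A root that becomes negative along the word must, at some letter, be the
    simple root of that letter; this letter can then be deleted. *)
Lemma exchange s r : positive D (- (rW (word s) *m al r)) ->
  exists2 s', (size s' < size s)%N & word s' = (word s * t (al r))%g.
Proof.
elim: s => [|j s IHs].
  by rewrite /word big_nil repr_mx1 mul1mx (negPf (positiveN (positive_al r))).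
have js : word (j :: s) = (t (al j) * word s)%g by rewrite /word big_cons.
have srP : rW (word s) *m al r \in Phi D by apply: Phi_stable (wordW s) (al_Phi D r).
rewrite js reprM ?wordW ?tW ?al_Phi //.
have [pos neg|/IHs[s' lt_s' ws'] _] := root_sign srP; last first.
  by exists (j :: s') => //; rewrite /word big_cons -/(word s') ws' mulgA.
have [e|ne] := eqVneq (rW (word s) *m al r) (al j); last first.
  by have := positiveN (positive_t pos ne); rewrite neg.
exists s => //.
have <- : (word s * t (al r) = t (al j) * word s)%g.
  by rewrite -e tJ ?al_Phi ?wordW // /conjg invgK !mulgA mulgKV.
by rewrite -mulgA t_sqr ?al_Phi // mulg1.
Qed.

(** The group acts freely on chambers. In a word of minimal length that
    keeps the simple roots positive, the last letter could be removed by the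
    exchange condition together with another one. *)
Lemma word_eq1 s : (forall i, positive D (rW (word s) *m al i)) -> word s = 1%g.
Proof.
have [k] := ubnP (size s); elim: k s => // k IHk s.
case/lastP: s => [|s r]; first by rewrite /word big_nil.
have sr : word (rcons s r) = (word s * t (al r))%g by rewrite /word big_rcons.
rewrite size_rcons ltnS => le_k pos; have := pos r.
rewrite sr reprM ?wordW ?tW ?al_Phi // t_neg ?al_Phi // mulmxN.
case/exchange=> s' lt_s' es'; rewrite -es'; apply: IHk.
  exact: leq_trans lt_s' (ltnW le_k).
by move=> i; rewrite es' -sr.
Qed.

End Roots.

(** * Connectedness of the simple roots *)

Section Connected.
Variables (R : realType) (n : nat) (gT : finGroupType) (W : {group gT}).
Variables (rW : mx_representation R W n) (D : root_data rW).
Hypothesis hW : irreducible_reflection_group rW.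
Local Notation V := 'cV[R]_n.
Local Notation al := (tnth (Pi D)).
Local Notation cf := (coord (Pi D)).
Local Notation t := (t rW).

Lemma dot_cf u (v : V) : dot u v = \sum_i cf i v * dot u (al i).
Proof.
rewrite [in LHS](cfE D v) dot_sumr; apply: eq_bigr => i _; exact: dotZr.
Qed.

Lemma cf_t i j (v : V) : cf j (rW (t (al i)) *m v) = cf j v - refl_coef D i v * (i == j)%:R.
Proof.
have [_ ->] := tP (al_Phi D i); rewrite refl_mxE -/(refl_coef D i v).
by rewrite linearB linearZ /= cf_al.
Qed.

Lemma al_neq0 i : al i != 0.
Proof. exact: Phi_neq0 (al_Phi D i). Qed.

Lemma refl_coef_gt0 i (v : V) : (0 < refl_coef D i v) = (0 < dot (al i) v).
Proof. by rewrite /refl_coef pmulr_rgt0 // divr_gt0 // dot_gt0 ?al_neq0. Qed.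

(** Otherwise reflecting one of the two simple roots in the other would give
    a root with coordinates of both signs. *)
Lemma obtuse i j : i != j -> dot (al i) (al j) <= 0.
Proof.
move=> ij; rewrite leNgt -refl_coef_gt0 -leNgt.
have ne : al j != al i by apply: contra_neq ij => /(@al_inj _ _ _ _ _ D).
have /andP[_ /forallP/(_ i)] := positive_t (positive_al D j) ne.
by rewrite cf_t cf_al eqxx (eq_sym j) (negPf ij) mulr1 sub0r oppr_ge0.
Qed.

Definition orthogonal_split (I : {set 'I_n}) : Prop :=
  forall i j, i \in I -> j \notin I -> dot (al i) (al j) = 0.

Lemma orthogonal_splitC I : orthogonal_split I -> orthogonal_split (~: I).
Proof. by move=> oI i j; rewrite !inE negbK => iI jI; rewrite dotC oI. Qed.

Definition meets (I : {set 'I_n}) (v : V) := [exists i in I, 0 < cf i v].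

Lemma positive_cf_ge0 a i : positive D a -> 0 <= cf i a.
Proof. by case/andP=> _ /forallP. Qed.

(** The case [i \in I] of a descent on positive roots supported on both
    sides of an orthogonal splitting: such a root stays of this kind after
    reflection in a simple root that makes an acute angle with it. *)
Lemma meets_t I i b : orthogonal_split I -> i \in I -> positive D b ->
    meets (~: I) b -> 0 < dot (al i) b ->
  [/\ positive D (rW (t (al i)) *m b), meets I (rW (t (al i)) *m b) &
      meets (~: I) (rW (t (al i)) *m b)].
Proof.
move=> oI iI bpos /exists_inP[j]; rewrite inE => jI bj bi.
set b' := _ *m b.
have bne : b != al i.
  apply: contraTneq bj => ->; rewrite cf_al; case: eqP => [ij|]; last by rewrite ltxx.
  by rewrite -ij iI in jI.
have b'pos := positive_t bpos bne.
split=> //; last first.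
  apply/exists_inP; exists j; rewrite ?inE // cf_t.
  case: eqP => [ij|_]; last by rewrite mulr0 subr0.
  by rewrite -ij iI in jI.
apply: contraT; rewrite negb_exists_in => /forall_inP b'0.
have : dot (al i) b' = 0.
  rewrite dot_cf big1 // => k _; have [kI|kI] := boolP (k \in I).
    have -> : cf k b' = 0.
      by apply/eqP; rewrite eq_le positive_cf_ge0 // andbT leNgt b'0.
    by rewrite mul0r.
  by rewrite oI ?mulr0.
have [_ ti] := tP (al_Phi D i).
rewrite /b' ti refl_mxE dotDr dotNr dotZr mulrAC divfK ?gt_eqF ?dot_gt0 ?al_neq0 //.
lra.
Qed.

(** Among the positive roots supported on both sides, one of least height
    makes an acute angle with some simple root, as it has positive norm;
    reflecting it there lowers the height. *)
Lemma not_mixed I b : orthogonal_split I -> positive D b ->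
  meets I b -> meets (~: I) b -> False.
Proof.
move=> oI bpos bI bC.
have bP : b \in Phi D by case/andP: bpos.
pose ht (a : seq_sub (Phi D)) : R := \sum_i cf i (ssval a).
pose P (a : seq_sub (Phi D)) :=
  [&& positive D (ssval a), meets I (ssval a) & meets (~: I) (ssval a)].
have Pb : P (SeqSub bP) by rewrite /P /= bpos bI.
case: (Order.TotalTheory.arg_minP ht Pb) => -[a aP] /and3P[/= apos aI aC] amin.
have [i ci di] : exists2 i, 0 < cf i a & 0 < dot (al i) a.
  have : 0 < dot a a by rewrite dot_gt0 // (Phi_neq0 aP).
  rewrite dot_cf => h; have [/existsP[i /andP[]]|/existsPn no] :=
    boolP [exists i, (0 < cf i a) && (0 < dot (al i) a)]; first by exists i.
  move: h; rewrite ltNge sumr_le0 // => i _.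
  have := no i; rewrite negb_and -!leNgt => /orP[h|h].
    have -> : cf i a = 0 by apply/eqP; rewrite eq_le h positive_cf_ge0.
    by rewrite mul0r.
  by rewrite dotC mulr_ge0_le0 // positive_cf_ge0.
have [a'pos a'I a'C] : [/\ positive D (rW (t (al i)) *m a),
    meets I (rW (t (al i)) *m a) & meets (~: I) (rW (t (al i)) *m a)].
  have [iI|iI] := boolP (i \in I); first exact: meets_t.
  have [] := @meets_t (~: I) i a; rewrite ?inE ?setCK //.
  exact: orthogonal_splitC.
have a'P : rW (t (al i)) *m a \in Phi D by case/andP: a'pos.
have := amin (SeqSub a'P); rewrite /P /= a'pos a'I a'C => /(_ erefl).
rewrite /ht /= leNgt; under [X in X < _]eq_bigr do rewrite cf_t.
have -> : \sum_k (cf k a - refl_coef D i a * (i == k)%:R) = \sum_k cf k a - refl_coef D i a.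
  rewrite sumrB; congr (_ - _).
  rewrite (bigD1 i) //= eqxx mulr1 big1 ?addr0 // => k ki.
  by rewrite eq_sym (negPf ki) mulr0.
by rewrite ltrBlDr ltrDl refl_coef_gt0 di.
Qed.

Lemma root_split I b : orthogonal_split I -> b \in Phi D ->
  (forall i, i \notin I -> cf i b = 0) \/ (forall i, i \in I -> cf i b = 0).
Proof.
move=> oI; wlog bpos : b / positive D b => [h bP|_].
  have [/h|/h] := root_sign bP; first by apply.
  rewrite PhiNE => /(_ bP)[] h'; [left|right] => i /h';
  by rewrite linearN /= => /eqP; rewrite oppr_eq0 => /eqP.
have cf0 i : ~~ (0 < cf i b) -> cf i b = 0.
  by rewrite -leNgt => h; apply/eqP; rewrite eq_le h positive_cf_ge0.
have [bI|] := boolP (meets I b); last first.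
  by rewrite negb_exists_in => /forall_inP no; right=> i /no /cf0.
have [bC|] := boolP (meets (~: I) b); first by case: (not_mixed oI bpos bI bC).
rewrite negb_exists_in => /forall_inP no; left=> i iI; apply: cf0.
by apply: no; rewrite inE.
Qed.

(** By [root_split] the span of one side of an orthogonal splitting is
    stable under all reflections, hence under the whole group. *)
Lemma Pi_connected I : orthogonal_split I -> I = set0 \/ I = setT.
Proof.
move=> oI; have [->|[i0 i0I]] := set_0Vmem I; first by left.
have [/setP IT|[j0]] := set_0Vmem (~: I).
  by right; apply/setP => i; have := IT i; rewrite !inE => /negbFE ->.
rewrite inE => j0I.
(* Irreducibility is about row vectors, on which the group acts by transposes;
   reflections are symmetric. *)
pose X : 'M[R]_n := \matrix_(i < n) (if i \in I then (al i)^T else 0).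
have rowX i : i \in I -> row i X = (al i)^T by move=> iI; rewrite rowK iI.
have X_mod : mxmodule rW X.
  rewrite /mxmodule -(rg_generated hW) gen_subG.
  apply/subsetP => w wT; have wW : w \in W by move: wT; rewrite inE => /andP[].
  rewrite inE wW /=; have [a aP ->] := reflection_Phi D wT.
  apply/row_subP => i; rewrite row_mul.
  have [iI|iI] := boolP (i \in I); last by rewrite rowK (negPf iI) mul0mx sub0mx.
  rewrite rowX // -(refl_mx_tr a) -trmx_mul.
  have alX k : k \in I -> ((al k)^T <= X)%MS by move=> kI; rewrite -rowX // row_sub.
  have [a0|a0] := root_split oI aP.
    rewrite refl_mxE linearB /= addmx_sub ?alX // eqmx_opp linearZ /= scalemx_sub //.
    rewrite (cfE D a) linear_sum /= summx_sub // => k _; rewrite linearZ /=.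
    have [kI|/a0 ->] := boolP (k \in I); first by rewrite scalemx_sub ?alX.
    by rewrite scale0r sub0mx.
  rewrite refl_mx_orth ?alX // dotC dot_cf big1 // => k _.
  by have [/a0 ->|kI] := boolP (k \in I); rewrite ?mul0r // oI ?mulr0.
have X_neq0 : X != 0.
  apply: contraNneq (al_neq0 i0) => X0; rewrite -[al i0]trmxK -rowX // X0.
  by rewrite linear0 trmx0.
have [_ _ /(_ X X_mod (submx1 _) X_neq0)] := rg_irreducible hW.
move/(submx_trans (submx1 (al j0)^T))/submxP => [d d_eq].
have Xj0 : X *m al j0 = 0.
  apply/row_matrixP => i; rewrite row_mul linear0.
  have [iI|iI] := boolP (i \in I); last by rewrite rowK (negPf iI) mul0mx.
  by rewrite rowX // dotE oI // raddf0.
have : dot (al j0) (al j0) == 0 by rewrite /dot d_eq -mulmxA Xj0 mulmx0 mxE.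
by rewrite dot_eq0 (negPf (al_neq0 j0)).
Qed.

End Connected.

(** * The Coxeter plane *)

Section Chebyshev.
Variables (R : realType) (mu : R).

(** The values [sin (k theta) / sin theta] when [mu = 2 cos theta]. *)
Fixpoint cheb (k : nat) : R :=
  if k is k'.+1 then
    if k' is k''.+1 then mu * cheb k' - cheb k'' else 1
  else 0.

Lemma chebSS k : cheb k.+2 = mu * cheb k.+1 - cheb k.
Proof. by []. Qed.

(** The Casoratian of the recurrence is constant. *)
Lemma cheb_cross k d : cheb (k + d) * cheb k.+1 - cheb (k + d).+1 * cheb k = cheb d.
Proof.
elim: k => [|k IHk]; first by rewrite mulr0 subr0 mulr1.
by rewrite -{}IHk addSn !chebSS; ring.
Qed.

End Chebyshev.

Section Layers.
Variables (R : realType) (n : nat) (gT : finGroupType) (W : {group gT}).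
Variables (rW : mx_representation R W n) (D : root_data rW).
Hypothesis hW : irreducible_reflection_group rW.
Local Notation V := 'cV[R]_n.
Local Notation al := (tnth (Pi D)).
Local Notation cf := (coord (Pi D)).
Local Notation t := (t rW).
Local Notation black := (black D).
Local Notation L := (Pi_layer D).
Local Notation h := (coxnum D).

(** Perron vector of the Gram matrix, rescaled so that its eigenvector
    equation involves the Cartan coefficients. When all simple roots have
    the same color, the equation holds for any weights with [mu = 0], which
    puts the first zero of [cheb] at [2]. *)
Lemma perron_simple : exists (z : 'I_n -> R) (mu : R),
  [/\ forall i, 0 < z i,
      forall j, \sum_(i | (i \in black) != (j \in black)) z i * refl_coef D i (al j)
                = - (mu * z j) &
      black != set0 /\ ~: black != set0 \/ mu = 0].
Proof.
have [[b0 bT]|one] := pselect (black != set0 /\ ~: black != set0); last first.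
  exists (fun=> 1), 0; split=> [i|j|]; [exact: ltr01| |by right].
  rewrite mul0r oppr0 big1 // => i ij; case: one; split.
    case/boolP: (i \in black) ij => [iB _|_]; first by apply/set0Pn; exists i.
    by case/boolP: (j \in black) => // jB _; apply/set0Pn; exists j.
  case/boolP: (j \in black) ij => [_|jB _]; last by apply/set0Pn; exists j; rewrite inE.
  by case/boolP: (i \in black) => // iB _; apply/set0Pn; exists i; rewrite inE.
have n_gt0 : (0 < n)%N by case/set0Pn: b0 => -[i ltin] _; apply: leq_ltn_trans ltin.
pose g i j := dot (al i) (al j).
have g_diag i : 0 < g i i by rewrite dot_gt0 // al_neq0.
have [y [l [y_ge0 [i0 yi0] yE]]] := @perron_vector R n g n_gt0
  (fun i j => dotC _ _) g_diag (fun i j => @obtuse _ _ _ _ _ D i j).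
have [I0|IT] : [set i | 0 < y i] = set0 \/ [set i | 0 < y i] = setT.
- apply: (Pi_connected (D := D) hW) => i j; rewrite !inE => yi yj.
  have yj0 : y j = 0 by apply/eqP; rewrite eq_le y_ge0 andbT leNgt.
  have := yE j; rewrite yj0 !mulr0 => /eqP.
  rewrite -oppr_eq0 -sumrN psumr_eq0 => [|k _]; last first.
    have [->|kj] := eqVneq k j; first by rewrite yj0 mulr0 oppr0.
    by rewrite oppr_ge0 mulr_le0_ge0 // obtuse // eq_sym.
  move/allP/(_ i (mem_index_enum _)); rewrite /= oppr_eq0 mulf_eq0 (gt_eqF yi) orbF.
  by rewrite /g dotC => /eqP.
- by move/setP/(_ i0): I0; rewrite !inE yi0.
exists (fun i => g i i * y i), (2 - 2 * l); split=> [i|j|]; last by left.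
  by rewrite mulr_gt0 //; move/setP/(_ i): IT; rewrite !inE.
have -> : \sum_(i | (i \in black) != (j \in black)) g i i * y i * refl_coef D i (al j)
          = 2 * \sum_(i | (i \in black) != (j \in black)) g j i * y i.
  rewrite mulr_sumr; apply: eq_bigr => i _; rewrite /refl_coef -/(g i j) -/(g i i).
  by rewrite /g (dotC (al j)); field; rewrite gt_eqF ?g_diag.
have := yE j; rewrite (bigID (fun i => (i \in black) != (j \in black))) /=.
rewrite [X in _ + X](bigD1 j) ?eqxx //= [X in _ + (_ + X)]big1 => [|i /andP[ij ji]].
  by rewrite addr0 => e; rewrite [X in 2 * X](_ : _ = l * (g j j * y j) - g j j * y j);
     [ring | rewrite -e addrK].
move/negPn/eqP: ij => ij.
by rewrite /g dotC (Pi_bipartite (r := D) ji ij) mul0r.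
Qed.

Lemma cB_W : cB D \in W. Proof. exact: prod_refl_W. Qed.
Lemma cW_W : cW D \in W. Proof. exact: prod_refl_W. Qed.
Lemma cox_W : cox D \in W. Proof. by rewrite groupM ?cB_W ?cW_W. Qed.

Lemma group_ext x y : x \in W -> y \in W -> (forall v : V, rW x *m v = rW y *m v) -> x = y.
Proof.
move=> xW yW e; apply: (rW_inj hW) => //.
apply/matrixP => i j; have := congr1 (fun M : V => M i 0) (e (delta_mx j 0)).
by rewrite -!colE !mxE.
Qed.

Lemma cB_sqr : (cB D * cB D = 1)%g.
Proof.
apply: group_ext => [||v]; rewrite ?groupM ?cB_W //.
by rewrite repr_mx1 mul1mx reprM ?cB_W // cBK.
Qed.

Lemma cW_sqr : (cW D * cW D = 1)%g.
Proof.
apply: group_ext => [||v]; rewrite ?groupM ?cW_W //.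
by rewrite repr_mx1 mul1mx reprM ?cW_W // cWK.
Qed.

Lemma layer0 : L 0 = [seq - a | a <- PiW D].
Proof.
by rewrite /Pi_layer expg0 repr_mx1 /= -[RHS]map_id; apply: eq_map => a; rewrite mul1mx.
Qed.

Lemma layer1 : L 1 = PiB D.
Proof.
by rewrite /Pi_layer expg0 repr_mx1 /= -[RHS]map_id; apply: eq_map => a; rewrite mul1mx.
Qed.

Lemma layerSS k : L k.+2 = [seq rW (cox D) *m a | a <- L k].
Proof.
rewrite /Pi_layer /= negbK expgS -map_comp; apply: eq_map => a /=.
by rewrite reprM ?groupX ?cox_W.
Qed.

Lemma nat_ind2 (P : nat -> Prop) :
  P 0%N -> P 1%N -> (forall k, P k -> P k.+2) -> forall k, P k.
Proof.
move=> P0 P1 PSS k; suff: P k /\ P k.+1 by case.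
by elim: k => [|k [Pk Pk1]]; split=> //; apply: PSS.
Qed.

Lemma layer_Phi k : {subset L k <= Phi D}.
Proof.
elim/nat_ind2: k => [a|a|k IHk a].
- by rewrite layer0 => /mapP[b /PiW_Pi/Pi_Phi bP ->]; apply: PhiN.
- by rewrite layer1 => /PiB_Pi/Pi_Phi.
- by rewrite layerSS => /mapP[b /IHk bP ->]; apply: Phi_stable bP; apply: cox_W.
Qed.

Lemma size_layer k : size (L k) = if odd k then #|black| else #|~: black|.
Proof.
elim/nat_ind2: k => [||k IHk].
- by rewrite layer0 size_map size_image.
- by rewrite layer1 size_image.
- by rewrite layerSS size_map IHk /= negbK.
Qed.

Lemma uniq_layer k : uniq (L k).
Proof.
elim/nat_ind2: k => [||k IHk].
- rewrite layer0 map_inj_uniq; last exact: oppr_inj.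
  by rewrite map_inj_uniq ?enum_uniq //; apply: al_inj.
- by rewrite layer1 map_inj_uniq ?enum_uniq //; apply: al_inj.
- by rewrite layerSS map_inj_uniq // => u v; apply: cox_inj.
Qed.

Section Plane.
Variables (z : 'I_n -> R) (mu : R).
Hypothesis z_gt0 : forall i, 0 < z i.
Hypothesis zE : forall j,
  \sum_(i | (i \in black) != (j \in black)) z i * refl_coef D i (al j) = - (mu * z j).
Hypothesis colours : black != set0 /\ ~: black != set0 \/ mu = 0.

Definition wsum (f : 'I_n -> R) (v : V) := \sum_i f i * cf i v.

(** The adjoint action of a product of orthogonal simple reflections on
    linear forms. *)
Lemma wsum_prod_refl f (J : {set 'I_n}) (v : V) : {in J &, forall i j, i != j -> dot (al i) (al j) = 0} ->
  wsum f (rW (prod_refl D J) *m v) =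
  wsum (fun j => f j - \sum_(i in J) f i * refl_coef D i (al j)) v.
Proof.
move=> oJ; have refl_coef_cf i : refl_coef D i v = \sum_j cf j v * refl_coef D i (al j).
  by rewrite /refl_coef (dot_cf D _ v) mulr_sumr; apply: eq_bigr => j _; ring.
rewrite prod_reflE // /wsum.
have -> : \sum_i f i * cf i (v - \sum_(j in J) refl_coef D j v *: al j) =
    \sum_i f i * cf i v - \sum_(i in J) f i * refl_coef D i v.
  rewrite [\sum_(i in J) f i * _]big_mkcond /= -sumrB; apply: eq_bigr => i _.
  rewrite linearB linear_sum mulrBr; congr (_ - _) => /=.
  have [iJ|iJ] := boolP (i \in J).
    rewrite (bigD1 i) //= big1 ?addr0 => [|j /andP[_ /negPf ji]].
      by rewrite linearZ /= cf_al eqxx mulr1.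
    by rewrite linearZ /= cf_al ji mulr0.
  rewrite big1 ?mulr0 // => j jJ; rewrite linearZ /= cf_al.
  by case: eqP => [ji|_]; rewrite ?mulr0 // -ji jJ in iJ *.
under [X in _ - X]eq_bigr do rewrite refl_coef_cf mulr_sumr.
rewrite exchange_big /= -sumrB; apply: eq_bigr => j _.
by rewrite mulrBl mulr_suml; congr (_ - _); apply: eq_bigr => i _; ring.
Qed.

(** The plane of linear forms spanned by the black part and the white part
    of the Perron vector; it meets the interior of the fundamental chamber
    of the dual space. *)
Definition phi (a b : R) := wsum (fun i => (if i \in black then a else b) * z i).

Lemma refl_coef_same i j : (i \in black) = (j \in black) -> j != i ->
  refl_coef D i (al j) = 0.
Proof.
move=> ij; rewrite eq_sym => ji.
by rewrite /refl_coef (Pi_bipartite (r := D) ji ij) mulr0.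
Qed.

Lemma zB j : \sum_(i in black) z i * refl_coef D i (al j) =
  if j \in black then 2 * z j else - (mu * z j).
Proof.
have [jB|jB] := boolP (j \in black).
  rewrite (bigD1 j) //= refl_coef_al big1 ?addr0 1?mulrC // => i /andP[iB ij].
  by rewrite refl_coef_same ?mulr0 1?eq_sym // iB jB.
by rewrite -zE; apply: eq_bigl => i; rewrite (negPf jB) eqbF_neg negbK.
Qed.

Lemma zW j : \sum_(i in ~: black) z i * refl_coef D i (al j) =
  if j \in black then - (mu * z j) else 2 * z j.
Proof.
have [jB|jB] := boolP (j \in black).
  by rewrite -zE; apply: eq_bigl => i; rewrite inE jB eqb_id.
rewrite (bigD1 j) ?inE //= refl_coef_al big1 ?addr0 1?mulrC // => i /andP[iB ij].
rewrite refl_coef_same ?mulr0 1?eq_sym // (negPf jB); apply/negbTE.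
by rewrite inE in iB.
Qed.

Lemma phi_cB a b v : phi a b (rW (cB D) *m v) = phi (- a) (b + mu * a) v.
Proof.
rewrite /phi wsum_prod_refl; last exact: orth_black.
apply: eq_bigr => j _; congr (_ * _).
have -> : \sum_(i in black) (if i \in black then a else b) * z i * refl_coef D i (al j)
    = a * \sum_(i in black) z i * refl_coef D i (al j).
  by rewrite mulr_sumr; apply: eq_bigr => i ->; rewrite mulrA.
by rewrite zB; case: ifP => _; ring.
Qed.

Lemma phi_cW a b v : phi a b (rW (cW D) *m v) = phi (a + mu * b) (- b) v.
Proof.
rewrite /phi wsum_prod_refl; last exact: orth_white.
apply: eq_bigr => j _; congr (_ * _).
have -> : \sum_(i in ~: black) (if i \in black then a else b) * z i * refl_coef D i (al j)
    = b * \sum_(i in ~: black) z i * refl_coef D i (al j).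
  rewrite mulr_sumr; apply: eq_bigr => i; rewrite inE => /negPf ->.
  by rewrite mulrA.
by rewrite zW; case: ifP => _; ring.
Qed.

Lemma phi_cox a b v :
  phi a b (rW (cox D) *m v) = phi (mu * (b + mu * a) - a) (- (b + mu * a)) v.
Proof. by rewrite coxE phi_cB phi_cW; congr (phi _ _ _); ring. Qed.

Lemma phiN a b v : phi a b (- v) = - phi a b v.
Proof. by rewrite /phi /wsum -sumrN; apply: eq_bigr => i _; rewrite linearN mulrN. Qed.

Lemma phi_al a b i : phi a b (al i) = (if i \in black then a else b) * z i.
Proof.
rewrite /phi /wsum (bigD1 i) //= cf_al eqxx mulr1 big1 ?addr0 // => j ji.
by rewrite cf_al eq_sym (negPf ji) mulr0.
Qed.

Lemma phi_ge0 a b v : 0 <= a -> 0 <= b -> positive D v -> 0 <= phi a b v.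
Proof.
move=> a0 b0 vpos; apply: sumr_ge0 => i _.
rewrite mulr_ge0 ?positive_cf_ge0 // mulr_ge0 //; first by case: ifP.
exact: ltW.
Qed.

Lemma phi_gt0_positive v : v \in Phi D -> 0 < phi 1 1 v -> positive D v.
Proof.
move=> vP v0; have [//|vn] := root_sign vP.
have := phi_ge0 ler01 ler01 vn; rewrite phiN.
by rewrite oppr_ge0 leNgt v0.
Qed.

Lemma phi10_eq0 v : positive D v -> phi 1 0 v = 0 -> v \in PiW D.
Proof.
move=> vpos v0; apply: contraT => /(positive_cf_gt0 (@orth_white _ _ _ _ _ D) vpos)[i].
rewrite inE negbK => iB vi; move: v0 => /eqP; rewrite /phi /wsum psumr_eq0 => [|j _].
  move/allP/(_ i (mem_index_enum _)); rewrite iB mul1r mulf_eq0.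
  by rewrite (gt_eqF vi) (gt_eqF (z_gt0 i)).
rewrite mulr_ge0 ?positive_cf_ge0 // mulr_ge0 ?(ltW (z_gt0 _)) //.
by case: ifP.
Qed.

Lemma phi01_eq0 v : positive D v -> phi 0 1 v = 0 -> v \in PiB D.
Proof.
move=> vpos v0; apply: contraT => /(positive_cf_gt0 (@orth_black _ _ _ _ _ D) vpos)[i].
move=> iB vi; move: v0 => /eqP; rewrite /phi /wsum psumr_eq0 => [|j _].
  move/allP/(_ i (mem_index_enum _)); rewrite (negPf iB) mul1r mulf_eq0.
  by rewrite (gt_eqF vi) (gt_eqF (z_gt0 i)).
rewrite mulr_ge0 ?positive_cf_ge0 // mulr_ge0 ?(ltW (z_gt0 _)) //.
by case: ifP.
Qed.

Local Notation u := (cheb mu).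

Lemma phi_layer0 x : x \in L 0 -> exists2 i, i \notin black & forall a b, phi a b x = - (b * z i).
Proof.
rewrite layer0 => /mapP[_ /imageP[i + ->] ->]; rewrite inE => iW.
by exists i => // a b; rewrite phiN phi_al (negPf iW).
Qed.

(** Since the weights are positive, the roots of a layer all have the same
    sign, and a single scalar sequence decides which layers are positive. *)
Lemma phi_layer k x : x \in L k.+1 ->
  exists i, forall a b, phi a b x = z i * (a * u k.+1 + b * u k).
Proof.
elim/nat_ind2: k x => [x|x|k IHk x].
- rewrite layer1 => /imageP[i iB ->]; exists i => a b.
  by rewrite phi_al iB /=; ring.
- rewrite layerSS => /mapP[y /phi_layer0[i iW yE] ->]; exists i => a b.
  by rewrite phi_cox yE /=; ring.
- rewrite layerSS => /mapP[y /IHk[i yE] ->]; exists i => a b.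
  by rewrite phi_cox yE !chebSS; ring.
Qed.

(** Some value of the recurrence is nonpositive, since otherwise all layers
    would be positive, while layer [2 h] is layer [0], which is negative. At
    the first such value [N], a negative [u N] would make a root of layer
    [N] take values of both signs on positive forms. *)
Lemma cheb_zero : exists N, [/\ (1 < N)%N, u N = 0 & forall k, (0 < k < N)%N -> 0 < u k].
Proof.
case: colours => [[b0 w0]|mu0]; last first.
  exists 2; split=> //=; first by rewrite mu0; ring.
  by case=> [|[|]] //= _; apply: ltr01.
have : exists k, (0 < k)%N && (u k <= 0).
  apply: contrapT => no; have u_gt0 k : 0 < u k.+1.
    by rewrite ltNge; apply/negP => le0; apply: no; exists k.+1.
  have := size_layer 0; rewrite /=; case E: (L 0) => [|x s] /=.
    by move/esym/cards0_eq => w00; rewrite w00 eqxx in w0.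
  move=> _; have x0 : x \in L 0 by rewrite E mem_head.
  have : x \in L (h.*2.-1).+1.
    rewrite prednK ?double_gt0 ?order_gt0 // /Pi_layer odd_double doubleK.
    by rewrite expg_order; apply: x0.
  case/phi_layer=> i xE; have [j _ xE'] := phi_layer0 x0.
  have := xE 0 1; rewrite xE' !mul1r mul0r add0r => e.
  have := mulr_gt0 (z_gt0 i) (u_gt0 h.*2.-2); have := z_gt0 j.
  have -> : (h.*2.-2.+1 = h.*2.-1)%N by have := order_gt0 (cox D); rewrite -/h; lia.
  by rewrite -e; lra.
case/ex_minnP=> N /andP[N0 uN] Nmin.
have N1 : (1 < N)%N.
  by case: N N0 uN {Nmin} => [|[|N]] //= _; rewrite leNgt ltr01.
have u_pos k : (0 < k < N)%N -> 0 < u k.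
  case/andP=> k0 kN; rewrite ltNge; apply/negP => uk.
  by have := Nmin k; rewrite k0 uk leqNgt kN => /(_ erefl).
exists N; split=> //; apply/eqP; rewrite eq_le uN leNgt; apply/negP => uN0.
have : (0 < size (L N))%N by rewrite size_layer; case: ifP; rewrite card_gt0.
case E: (L N) => [|x s] //= _; have xN : x \in L N.-1.+1 by rewrite prednK // E mem_head.
have [i xE] := phi_layer xN; rewrite prednK // in xE.
(* The forms [phi 1 0] and [phi 0 1] are nonnegative on positive roots, but
   they take values of opposite signs on the root [x]. *)
have [xpos|xneg] := root_sign (layer_Phi xN).
  have := phi_ge0 ler01 (lexx 0) xpos; rewrite xE mul1r mul0r addr0 leNgt.
  by rewrite pmulr_rlt0 // uN0.
have := phi_ge0 (lexx 0) ler01 xneg; rewrite phiN xE mul1r mul0r add0r oppr_ge0 leNgt.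
by rewrite mulr_gt0 // u_pos //; case: (N) N1 => [|[|]] //=.
Qed.

End Plane.
End Layers.

(** * Steinberg's theorem on the layers of roots *)

Section Steinberg.
Variables (R : realType) (n : nat) (gT : finGroupType) (W : {group gT}).
Variables (rW : mx_representation R W n) (D : root_data rW).
Hypothesis hW : irreducible_reflection_group rW.
Local Notation V := 'cV[R]_n.
Local Notation al := (tnth (Pi D)).
Local Notation t := (t rW).
Local Notation black := (black D).
Local Notation L := (Pi_layer D).
Local Notation h := (coxnum D).

Lemma cox_pow_word k : exists s, (cox D ^+ k)%g = word D s.
Proof.
have [s0 s0E] : exists s, cox D = word D s.
  exists ([seq i <- index_enum _ | i \in black] ++ [seq i <- index_enum _ | i \in ~: black]).
  by rewrite /word big_cat /= !big_filter.
elim: k => [|k [s sE]]; first by exists [::]; rewrite /word big_nil.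
by exists (s0 ++ s); rewrite expgS sE s0E /word big_cat.
Qed.

Section Number.
Variables (z : 'I_n -> R) (mu : R) (N : nat).
Hypothesis z_gt0 : forall i, 0 < z i.
Hypothesis zE : forall j,
  \sum_(i | (i \in black) != (j \in black)) z i * refl_coef D i (al j) = - (mu * z j).
Local Notation u := (cheb mu).
Hypotheses (N_gt1 : (1 < N)%N) (uN : u N = 0)
  (u_gt0 : forall k, (0 < k < N)%N -> 0 < u k).

Let phiL := phi_layer (D := D) zE.

Lemma layer_pos_N k x : (0 < k <= N)%N -> x \in L k -> positive D x.
Proof.
case: k => // k /= kN xk; have [i xE] := phiL xk.
apply: (phi_gt0_positive z_gt0); first exact: (layer_Phi xk).
rewrite xE !mul1r; apply: mulr_gt0 => //.
have [e|kN'] := eqVneq k.+1 N.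
  rewrite e uN add0r; apply: u_gt0; lia.
case: k {xk xE} kN kN' => [|k] kN kN'; first by rewrite /= addr0 ltr01.
by apply: addr_gt0; apply: u_gt0; lia.
Qed.

(** If two layers of index [k < k' <= N] share a root, the vectors [(u_k,
    u_(k-1))] and [(u_k', u_(k'-1))] are proportional, so that [u_(k'-k) =
    0] by [cheb_cross]. *)
Lemma layer_disj_N k k' x : (0 < k)%N -> (k < k' <= N)%N -> x \in L k -> x \in L k' -> False.
Proof.
case: k => // k _; case: k' => // k' kk' xk xk'.
have [i xi] := phiL xk; have [j xj] := phiL xk'.
have := u_gt0 (k := (k' - k)%N); have -> : (0 < k' - k < N)%N by lia.
move/(_ isT); rewrite -(cheb_cross mu k) subnKC; last by lia.
have e1 : z i * u k.+1 = z j * u k'.+1 by have := xi 1 0; rewrite (xj 1 0); lra.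
have e0 : z i * u k = z j * u k' by have := xi 0 1; rewrite (xj 0 1); lra.
have zi := z_gt0 i; have zj := z_gt0 j => lt0.
have := mulr_gt0 (mulr_gt0 zi zj) lt0.
suff -> : z i * z j * (u k' * u k.+1 - u k'.+1 * u k) = 0 by rewrite ltxx.
have -> : z i * z j * (u k' * u k.+1 - u k'.+1 * u k) =
  (z i * u k.+1) * (z j * u k') - (z j * u k'.+1) * (z i * u k) by ring.
by rewrite e1 e0; ring.
Qed.

(** As [u_N = 0], the roots of layer [N] vanish on one of the two axes of
    the plane of forms, and those of layer [N + 1] on the other. A positive
    root with no black (or no white) coordinate is simple, because the white
    (or black) simple roots are orthogonal. *)
Lemma layer_last_sub : {subset L N <= PiW D} /\ {subset L N.+1 <= map -%R (PiB D)}.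
Proof.
have NE : N = N.-1.+1 by rewrite prednK // ltnW.
split=> x xN.
  have xpos : positive D x by apply: layer_pos_N xN; rewrite leqnn andbT ltnW.
  apply: (phi10_eq0 z_gt0) => //; rewrite NE in xN; have [i ->] := phiL xN.
  by rewrite -NE uN !mul0r mul1r addr0 mulr0.
have [i xE] := phiL xN.
have uN1 : u N.+1 < 0.
  rewrite NE chebSS -NE uN mulr0 sub0r oppr_lt0; apply: u_gt0; lia.
apply/mapP; exists (- x); last by rewrite opprK.
have xpos : positive D (- x).
  apply: (phi_gt0_positive z_gt0); first by rewrite PhiNE; apply: (layer_Phi xN).
  by rewrite phiN xE uN !mul1r addr0 oppr_gt0 pmulr_rlt0.
by apply: (phi01_eq0 z_gt0) => //; rewrite phiN xE uN mul0r mul1r addr0 mulr0 oppr0.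
Qed.

Lemma layer_last_N : L N =i PiW D /\ L N.+1 =i map -%R (PiB D).
Proof.
(* Layers [N] and [N + 1] together have as many roots as there are simple
   roots, so that both inclusions are equalities. *)
have [sW sB] := layer_last_sub.
have := uniq_leq_size (uniq_layer D N) sW.
have := uniq_leq_size (uniq_layer D N.+1) sB.
rewrite !size_layer size_map !size_image /= => le1 le2.
split.
  apply: (uniq_min_size (uniq_layer D N) sW _).2.
  by rewrite size_layer size_image; case: (odd N) le1 le2 => //= ? ?; lia.
apply: (uniq_min_size (uniq_layer D N.+1) sB _).2.
by rewrite size_layer size_map size_image /=; case: (odd N) le1 le2 => //= ? ?; lia.
Qed.

Lemma layer_add_N k : L (k + N) =i map -%R (L k).
Proof.
have [LN LN1] := layer_last_N.
elim/nat_ind2: k => [||k IHk] x.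
- rewrite add0n LN layer0 -map_comp; congr (_ \in _).
  by rewrite -[LHS]map_id; apply: eq_map => a /=; rewrite opprK.
- by rewrite add1n LN1 layer1.
rewrite !addSn !layerSS (eq_mem_map _ IHk); congr (_ \in _).
by rewrite -!map_comp; apply: eq_map => a /=; rewrite mulmxN.
Qed.

Lemma layer_add_2N k : L (k + N + N) =i L k.
Proof.
move=> x; rewrite layer_add_N (eq_mem_map _ (layer_add_N k)) -map_comp; congr (_ \in _).
by rewrite -[RHS]map_id; apply: eq_map => a /=; rewrite opprK.
Qed.

Lemma layer_shift k d : L (k + d.*2) = [seq rW (cox D ^+ d)%g *m a | a <- L k].
Proof.
elim: d => [|d IHd].
  by rewrite addn0 expg0 repr_mx1 -[LHS]map_id; apply: eq_map => a; rewrite mul1mx.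
rewrite doubleS !addnS layerSS IHd -map_comp; apply: eq_map => a /=.
by rewrite expgS [RHS]reprM ?groupX ?cox_W.
Qed.

(** The power permutes the simple roots, as layers are periodic of period [2
    N]. *)
Lemma cox_pow_N : (cox D ^+ N = 1)%g.
Proof.
have [s sE] := cox_pow_word N; rewrite sE; apply: (word_eq1 hW) => i; rewrite -sE.
have mem k x : x \in L k -> rW (cox D ^+ N)%g *m x \in L k.
  by move=> xk; rewrite -layer_add_2N -addnA addnn layer_shift map_f.
have [iB|iW] := boolP (i \in black).
  apply: (@layer_pos_N 1); first lia.
  by apply: mem; rewrite layer1; apply/imageP; exists i.
have : - al i \in L 0.
  by rewrite layer0 map_f //; apply/imageP; exists i; rewrite ?inE.
move/mem; rewrite layer0 mulmxN => /mapP[a /PiW_Pi/positive_PiN[apos _]].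
by move/oppr_inj ->.
Qed.

(** If [c ^+ d = 1] with [d < N], then layer [2 d + 1] equals layer [1] and
    layer [2 d] equals layer [0]. Since there is a simple root, one of these
    coincidences is between nonempty layers; it is excluded by disjointness
    up to index [N] and by signs beyond. *)
Lemma cox_order_min d : (0 < d)%N -> (cox D ^+ d = 1)%g -> (N <= d)%N.
Proof.
move=> d0 cd; rewrite leqNgt; apply/negP => dN.
have Ld k : L (k + d.*2) = L k.
  by rewrite layer_shift cd repr_mx1 -[RHS]map_id; apply: eq_map => a; rewrite mul1mx.
have neg k x : x \in L (k + N) -> - x \in L k.
  by rewrite layer_add_N => /mapP[y yk ->]; rewrite opprK.
have [i _] : exists i : 'I_n, true.
  have [_ + _] := rg_irreducible hW; case: (n) => [|n']; last by exists ord0.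
  by rewrite [1%:M]flatmx0 eqxx.
have [iB|iW] := boolP (i \in black).
  have a1 : al i \in L 1 by rewrite layer1; apply/imageP; exists i.
  have := a1; rewrite -(Ld 1%N) => a2.
  have [le|lt] := leqP (1 + d.*2) N; first by apply: (@layer_disj_N 1 (1 + d.*2) (al i)) => //; lia.
  have ei : (1 + d.*2 = (1 + d.*2 - N) + N)%N by lia.
  rewrite ei in a2; have /layer_pos_N := neg _ _ a2.
  have -> : (0 < 1 + d.*2 - N <= N)%N by lia.
  by move/(_ isT); rewrite (negPf (positiveN (positive_al D i))).
have [LN _] := layer_last_N.
have aW : al i \in PiW D by apply/imageP; exists i; rewrite ?inE.
have a0 : - al i \in L 0 by rewrite layer0 map_f.
have := a0; rewrite -(Ld 0%N) add0n => a2.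
have [le|lt] := leqP d.*2 N.
  have : positive D (- al i) by apply: layer_pos_N a2; lia.
  by rewrite (negPf (positiveN (positive_al D i))).
have ei : (d.*2 = (d.*2 - N) + N)%N by lia.
rewrite ei in a2; have := neg _ _ a2; rewrite opprK => a3.
by apply: (@layer_disj_N (d.*2 - N) N (al i)); rewrite ?LN //; lia.
Qed.

Lemma coxnum_N : h = N.
Proof.
apply/eqP; rewrite eqn_leq cox_order_min ?order_gt0 ?expg_order // andbT.
by apply: dvdn_leq; [exact: ltnW | rewrite order_dvdn cox_pow_N].
Qed.

End Number.

Lemma steinberg : [/\ (1 < h)%N,
  forall k x, (0 < k <= h)%N -> x \in L k -> positive D x,
  forall k k' x, (0 < k)%N -> (k < k' <= h)%N -> x \in L k -> x \in L k' -> False,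
  L h =i PiW D & forall k, L (k + h) =i map -%R (L k)].
Proof.
have [z [mu [z0 zE col]]] := perron_simple D hW.
have [N [N1 uN u0]] := cheb_zero z0 zE col.
have hN : h = N by apply: coxnum_N z0 zE N1 uN u0.
rewrite hN; split=> //.
- exact: (@layer_pos_N z mu N).
- exact: (@layer_disj_N z mu N).
- by have [] := layer_last_N z0 zE N1 uN u0.
- exact: layer_add_N z0 zE N1 uN u0.
Qed.

Lemma coxnum_gt1 : (1 < h)%N. Proof. by have [] := steinberg. Qed.
Lemma layer_pos k x : (0 < k <= h)%N -> x \in L k -> positive D x.
Proof. by have [_ + _ _ _] := steinberg; apply. Qed.
Lemma layer_disj k k' x : (0 < k <= h)%N -> (0 < k' <= h)%N ->
  x \in L k -> x \in L k' -> k = k'.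
Proof.
have [_ _ disj _ _] := steinberg; case: (ltngtP k k') => // lt hk hk' xk xk'.
  by case: (disj k k' x) => //; lia.
by case: (disj k' k x) => //; lia.
Qed.
Lemma layer_last : L h =i PiW D. Proof. by have [] := steinberg. Qed.
Lemma layer_add k : L (k + h) =i map -%R (L k). Proof. by have [] := steinberg. Qed.

(** Layers [0] and [1] are immediate; the step from [k] to [k + 2] holds
    because [c_b] inverts [c]. *)
Lemma cB_layer k x : (k <= h.+2)%N -> x \in L k -> rW (cB D) *m x \in L (h.+2 - k).
Proof.
elim/nat_ind2: k x => [x _|x _|k IHk x].
- rewrite layer0 => /mapP[a aW ->]; rewrite subn0 -[h.+2]/(2 + h)%N layer_add layerSS layer0.
  apply/mapP; exists (rW (cB D) *m a); last by rewrite mulmxN.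
  apply/mapP; exists (- a); first exact: map_f.
  by rewrite coxE [rW (cW D) *m _]mulmxN cW_PiW // opprK.
- rewrite layer1 => aB; rewrite cB_PiB // subn1 -[h.+2.-1]/(1 + h)%N layer_add layer1.
  exact: map_f.
rewrite ltnS => kh; rewrite layerSS => /mapP[y yk ->].
have := IHk y (ltnW (leqW kh)) yk; have -> : (h.+2 - k = (h.+2 - k.+2).+2)%N by lia.
rewrite layerSS coxE cBK => /mapP[w wk]; rewrite coxE => /(can_inj (cBK D)) ->.
by rewrite cWK.
Qed.

End Steinberg.

(** * Blocks of colored roots under rotation *)

Section Blocks.
Variables (R : realType) (n : nat) (gT : finGroupType) (W : {group gT}).
Variables (rW : mx_representation R W n) (D : root_data rW).
Hypothesis hW : irreducible_reflection_group rW.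
Variables (m : nat) (m_gt0 : (0 < m)%N).
Local Notation V := 'cV[R]_n.
Local Notation al := (tnth (Pi D)).
Local Notation t := (t rW).
Local Notation black := (black D).
Local Notation L := (Pi_layer D).
Local Notation h := (coxnum D).
Local Notation block := (block D m).
Local Notation M := (m * h)%N.

Let h_gt1 : (1 < h)%N := coxnum_gt1 D hW.
Let h_gt0 : (0 < h)%N := ltnW h_gt1.

Lemma block_first : block 0 = [seq (- a, 1%N) | a <- PiW D].
Proof. by []. Qed.

Lemma block_last : block M.+1 = [seq (- a, 1%N) | a <- PiB D].
Proof. by rewrite /Defs.block /= eqxx. Qed.

Lemma mid_leq q j : (q < m)%N -> (j <= h)%N -> (q * h + j <= M)%N.
Proof.
move=> qm jh; apply: (@leq_trans (q.+1 * h)); last by rewrite leq_mul2r qm orbT.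
by rewrite mulSn addnC leq_add2r.
Qed.

Lemma block_mid q j : (q < m)%N -> (0 < j <= h)%N ->
  block (q * h + j) = [seq (a, m - q)%N | a <- L j].
Proof.
case: j => // j qm /= jh; have := mid_leq qm jh.
rewrite /Defs.block addnS /= => le; rewrite ltn_eqF ?ltnS //.
by rewrite divnMDl // divn_small // addn0 modnMDl modn_small.
Qed.

Variant block_index_spec : nat -> Prop :=
| FirstBlock : block_index_spec 0
| LastBlock : block_index_spec M.+1
| MidBlock q j of (q < m)%N & (0 < j <= h)%N : block_index_spec (q * h + j).

Lemma block_indexP k : (k <= M.+1)%N -> block_index_spec k.
Proof.
case: k => [|k]; first by constructor.
rewrite leq_eqVlt => /orP[/eqP->|]; first by constructor.
rewrite !ltnS => le; rewrite (divn_eq k h) -addnS.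
by constructor; [rewrite ltn_divLR // | rewrite ltn_mod].
Qed.

Lemma PiNpos a : a \in Pi D -> positive D (- a) = false.
Proof. by move=> aP; apply/negbTE; case: (positive_PiN aP). Qed.

Lemma block_disj k k' x : (k <= M.+1)%N -> (k' <= M.+1)%N ->
  x \in block k -> x \in block k' -> k = k'.
Proof.
have midP q j a i : (q < m)%N -> (0 < j <= h)%N -> (a, i) \in block (q * h + j) ->
    [/\ a \in L j, positive D a & i = (m - q)%N].
  move=> qm jh; rewrite block_mid // => /mapP[b bj [-> ->]]; split=> //.
  exact: layer_pos bj.
have BW a b : a \in PiB D -> b \in PiW D -> - a = - b -> False.
  by move=> /PiBW aB bW /oppr_inj ab; rewrite ab bW in aB.
case: x => a i /block_indexP[||q j qm jh] /block_indexP[||q' j' qm' jh'] //.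
- rewrite block_first block_last => /mapP[b bW [-> _]] /mapP[c cB [e _]].
  by case: (BW c b).
- rewrite block_first => /mapP[b /PiW_Pi/PiNpos nb [-> _]] /midP[] //.
  by rewrite nb.
- rewrite block_first block_last => /mapP[c cB [-> _]] /mapP[b bW [e _]].
  by case: (BW c b).
- rewrite block_last => /mapP[b /PiB_Pi/PiNpos nb [-> _]] /midP[] //.
  by rewrite nb.
- move=> /midP[] // _ apos _; rewrite block_first => /mapP[b /PiW_Pi/PiNpos nb [e _]].
  by rewrite e nb in apos.
- move=> /midP[] // _ apos _; rewrite block_last => /mapP[b /PiB_Pi/PiNpos nb [e _]].
  by rewrite e nb in apos.
move=> /midP[] // aj _ ei /midP[] // aj' _ ei'.
have -> : j = j' by apply: (layer_disj hW jh jh' aj aj').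
by have -> : q = q' by lia.
Qed.

Definition rotated (k : nat) : nat := if (h <= k)%N then (k - h)%N else (k + M.+2 - h)%N.

Lemma h_leM : (h <= M)%N.
Proof. by rewrite -[leqLHS]mul1n leq_mul2r m_gt0 orbT. Qed.

Lemma rotated_le k : (k <= M.+1)%N -> (rotated k <= M.+1)%N.
Proof. by rewrite /rotated; case: ifP; lia. Qed.

Lemma rotated_inj k k' : (k <= M.+1)%N -> (k' <= M.+1)%N -> rotated k = rotated k' -> k = k'.
Proof. by have := h_leM; rewrite /rotated; case: ifP; case: ifP; lia. Qed.

Lemma mid_last j : ((m.-1) * h + j = M - h + j)%N.
Proof. by rewrite -[in RHS](prednK m_gt0) mulSn addKn. Qed.

Lemma block_Phi k x : (k <= M.+1)%N -> x \in block k -> x.1 \in Phi D.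
Proof.
case/block_indexP=> [||q j qm jh].
- by rewrite block_first => /mapP[a /PiW_Pi/Pi_Phi aP ->]; apply: PhiN.
- by rewrite block_last => /mapP[a /PiB_Pi/Pi_Phi aP ->]; apply: PhiN.
- by rewrite block_mid // => /mapP[a aj ->]; apply: layer_Phi aj.
Qed.

(** The case of the last color splits according to the layer: layer [h] is
    sent to block [0], layer [h - 1] to the last block because layer [h + 1]
    is the opposite of layer [1], and the other layers move up by two. *)
Lemma Rraw_block k x : (k <= M.+1)%N -> x \in block k ->
  Rraw D m x \in block (rotated k) /\
  t (Rraw D m x).1 = if (h <= k)%N then t x.1 else (t x.1 ^ (cox D)^-1)%g.
Proof.
have hM := h_leM.
case/block_indexP=> [||q j qm jh].
- rewrite block_first => /mapP[a aW ->].
  have aPi := PiW_Pi aW.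
  have aB : (a \in PiB D) = false by apply: contraTF aW; apply: PiBW.
  have NaW : (- a \in PiW D) = false.
    by apply: contraFF (PiNpos aPi) => /PiW_Pi/positive_PiN[].
  rewrite /Rraw PiNpos // NaW opprK aB /= /rotated leqNgt h_gt0 /=.
  have NaP : - a \in Phi D by rewrite PhiNE; apply: Pi_Phi.
  rewrite (tJ hW NaP (cox_W D)).
  have -> : (0 + M.+2 - h = m.-1 * h + 2)%N by rewrite mid_last; lia.
  rewrite block_mid ?prednK //; split=> //.
  have -> : (m - m.-1 = 1)%N by lia.
  apply: (map_f (fun a => (a, 1%N))); rewrite layerSS map_f // layer0.
  exact: map_f.
- rewrite block_last => /mapP[a aB ->].
  have aPi := PiB_Pi aB.
  rewrite /Rraw PiNpos // opprK aB eqxx orbT /= /rotated.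
  have -> : (h <= M.+1)%N by lia.
  split; last by rewrite tN.
  have -> : (M.+1 - h = m.-1 * h + 1)%N by rewrite mid_last; lia.
  rewrite block_mid ?prednK // layer1.
  have -> : (m - m.-1 = 1)%N by lia.
  exact: (map_f (fun a => (a, 1%N))).
rewrite block_mid // => /mapP[a aj ->]; have apos := layer_pos hW jh aj.
have aP : a \in Phi D by case/andP: apos.
have [_ NaB] := positive_notin apos.
rewrite /Rraw apos NaB /= orbF; case: q qm => [|q] qm.
  rewrite subn0 ltnn eqxx andbT mul0n add0n /rotated.
  have [ej|jh'] := eqVneq j h.
    have aW : a \in PiW D by rewrite -(layer_last D hW) -ej.
    rewrite ej aW leqnn subnn tN; split=> //.
    by rewrite block_first; apply: (map_f (fun a => (- a, 1%N))).
  have aW : (a \in PiW D) = false.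
    apply: contra_neqF jh'; rewrite -(layer_last D hW) => ah.
    by apply: (layer_disj hW jh _ aj ah); rewrite h_gt0 leqnn.
  have lt_jh : (j < h)%N by rewrite ltn_neqAle jh'; case/andP: jh.
  rewrite aW leqNgt lt_jh /= (tJ hW aP (cox_W D)); split=> //.
  have caj : rW (cox D) *m a \in L j.+2 by rewrite layerSS map_f.
  have [lt|le] := ltnP j.+1 h.
    have -> : (j + M.+2 - h = m.-1 * h + j.+2)%N by rewrite mid_last; lia.
    rewrite block_mid ?prednK //; have -> : (m - m.-1 = 1)%N by lia.
    exact: (map_f (fun a => (a, 1%N))).
  have ej : (j.+2 = 1 + h)%N by lia.
  rewrite ej layer_add // layer1 in caj; case/mapP: caj => b bB ->.
  have -> : (j + M.+2 - h = M.+1)%N by lia.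
  by rewrite block_last; apply: (map_f (fun a => (- a, 1%N))).
have -> : (m - q.+1 < m)%N by lia.
have qm' : (q < m)%N by lia.
have le : (h <= q.+1 * h + j)%N by rewrite mulSn; lia.
rewrite /rotated le; split=> //.
have -> : (q.+1 * h + j - h = q * h + j)%N by rewrite mulSn; lia.
rewrite block_mid //; have -> : ((m - q.+1).+1 = m - q)%N by lia.
exact: (map_f (fun a => (a, m - q)%N)).
Qed.

End Blocks.

(** * Blocks under reflection, and products over blocks *)

Section CommutingProducts.
Variables (gT : finGroupType) (T : eqType) (F : T -> gT).
Local Open Scope group_scope.

(** A product over a set depends on the enumeration of the set when the
    group is not commutative, so that reindexing it takes an argument. *)
Lemma perm_prod_commute (s1 s2 : seq T) : perm_eq s1 s2 ->
    {in s1 &, forall x y, commute (F x) (F y)} ->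
  \prod_(x <- s1) F x = \prod_(x <- s2) F x.
Proof.
elim: s1 s2 => [|x s1 IHs] s2; first by move/perm_size/esym/size0nil ->.
move=> e; have xs2 : x \in s2 by rewrite -(perm_mem e) mem_head.
case/splitPr: xs2 e => p1 p2 e com.
have e' : perm_eq s1 (p1 ++ p2).
  by rewrite -(perm_cons x) (perm_trans e) // -cat1s perm_catCA.
rewrite big_cons big_cat /= big_cons (IHs _ e'); last first.
  by move=> y z ys zs; apply: com; rewrite inE ?ys ?zs orbT.
have xp1 : commute (F x) (\prod_(y <- p1) F y).
  rewrite big_seq; apply: commute_prod => y yp1; apply: com; rewrite inE ?eqxx //.
  by rewrite (perm_mem e') mem_cat yp1 orbT.
by rewrite big_cat /= !mulgA xp1.
Qed.

Lemma conjg_prod (s : seq T) z : (\prod_(x <- s) F x) ^ z = \prod_(x <- s) (F x ^ z).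
Proof.
by apply: (big_morph (fun x => x ^ z) _ (conj1g z)) => x y; apply: conjMg.
Qed.

Lemma prod_commute_invol (s : seq T) :
    {in s &, forall x y, commute (F x) (F y)} -> {in s, forall x, (F x)^-1 = F x} ->
  (\prod_(x <- s) F x)^-1 = \prod_(x <- s) F x.
Proof.
move=> com inv; rewrite -{1}(revK s) -prodgV.
rewrite [RHS](@perm_prod_commute _ (rev s)) //; last by rewrite perm_sym perm_rev.
by rewrite big_seq [RHS]big_seq; apply: eq_bigr => x; rewrite mem_rev; apply: inv.
Qed.

End CommutingProducts.

Lemma prod_ord_rev (gT : finGroupType) (b : nat -> gT) N :
  (\prod_(i < N.+1) b (N - i)%N = \prod_(i <- rev (iota 0 N.+1)) b i)%g.
Proof.
have -> : rev (iota 0 N.+1) = [seq (N - i)%N | i <- iota 0 N.+1].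
  apply: (@eq_from_nth _ 0%N); rewrite ?size_rev ?size_map // size_iota => i iN.
  by rewrite nth_rev ?size_iota // subSS (nth_map 0%N) ?size_iota // !nth_iota //; lia.
by rewrite big_map -(big_mkord xpredT (fun i => b (N - i)%N)) /index_iota subn0.
Qed.

(** Finiteness: a permutation that maps the union of the blocks into itself
    maps it onto itself, so the image of a block is caught by no other
    block. *)
Lemma perm_blocks (T : finType) (p : {perm T}) (P : nat -> pred T) N (r : nat -> nat) :
    (forall k, (k <= N)%N -> (r k <= N)%N) ->
    (forall k k', (k <= N)%N -> (k' <= N)%N -> r k = r k' -> k = k') ->
    (forall k k' x, (k <= N)%N -> (k' <= N)%N -> P k x -> P k' x -> k = k') ->
    (forall k x, (k <= N)%N -> P k x -> P (r k) (p x)) ->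
  forall k x, (k <= N)%N -> P (r k) (p x) = P k x.
Proof.
move=> rN rinj disj Pp k x kN; apply/idP/idP; last exact: Pp.
pose U := [set x | [exists k : 'I_N.+1, P k x]].
have memU j y : (j <= N)%N -> P j y -> y \in U.
  by move=> jN Py; rewrite inE; apply/existsP; exists (inord j); rewrite inordK.
have subU : p @: U \subset U.
  apply/subsetP => _ /imsetP[y + ->]; rewrite inE => /existsP[j Py].
  have jN : (j <= N)%N by rewrite -ltnS.
  exact: memU (rN _ jN) (Pp _ _ jN Py).
have eqU : p @: U = U.
  by apply/eqP; rewrite eqEcard subU (card_imset _ (@perm_inj _ p)) leqnn.
move=> Prk; have := memU _ _ (rN _ kN) Prk; rewrite -eqU (mem_imset _ _ (@perm_inj _ p)).
rewrite inE => /existsP[j Pj]; have jN : (j <= N)%N by rewrite -ltnS.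
have := disj _ _ _ (rN _ jN) (rN _ kN) (Pp _ _ jN Pj) Prk.
by move/(rinj _ _ jN kN) => <-.
Qed.

Section Faces.
Variables (R : realType) (n : nat) (gT : finGroupType) (W : {group gT}).
Variables (rW : mx_representation R W n) (D : root_data rW).
Hypothesis hW : irreducible_reflection_group rW.
Variables (m : nat) (m_gt0 : (0 < m)%N).
Local Notation V := 'cV[R]_n.
Local Notation al := (tnth (Pi D)).
Local Notation t := (t rW).
Local Notation L := (Pi_layer D).
Local Notation h := (coxnum D).
Local Notation block := (block D m).
Local Notation M := (m * h)%N.
Implicit Type f : {set croot D m}.

Let h_gt1 : (1 < h)%N := coxnum_gt1 D hW.
Let h_gt0 : (0 < h)%N := ltnW h_gt1.

Definition reflected (k : nat) : nat := if k == 0%N then 0%N else (M.+2 - k)%N.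

Lemma reflected_le k : (k <= M.+1)%N -> (reflected k <= M.+1)%N.
Proof. by rewrite /reflected; case: eqP; lia. Qed.

Lemma reflected_inj k k' : (k <= M.+1)%N -> (k' <= M.+1)%N ->
  reflected k = reflected k' -> k = k'.
Proof. by rewrite /reflected; case: eqP; case: eqP; lia. Qed.

Lemma tJ_cB a : a \in Phi D -> t (rW (cB D) *m a) = (t a ^ cB D)%g.
Proof.
move=> aP; rewrite (tJ hW aP (cB_W D)).
by have -> : ((cB D)^-1 = cB D)%g by rewrite -[LHS]mulg1 -(cB_sqr D hW) mulKg.
Qed.

Lemma tJ_PiB a : a \in PiB D -> (t a ^ cB D = t a)%g.
Proof. by move=> aB; rewrite -tJ_cB ?cB_PiB ?tN //; apply/Pi_Phi/PiB_Pi. Qed.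

Lemma Sraw_block k x : (k <= M.+1)%N -> x \in block k ->
  Sraw D m x \in block (reflected k) /\
  t (Sraw D m x).1 = if k == 0%N then t x.1 else (t x.1 ^ cB D)%g.
Proof.
case/(block_indexP hW)=> [||q j qm jh].
- rewrite block_first => /mapP[a aW ->].
  rewrite /Sraw opprK aW /= /reflected /=; split=> //.
  exact: (map_f (fun a => (- a, 1%N))).
- rewrite block_last => /mapP[a aB ->].
  rewrite /Sraw opprK (negPf (PiBW aB)) aB /= /reflected /= subSnn.
  split; last by rewrite tN tJ_PiB.
  rewrite -[1%N]/(0 * h + 1)%N (block_mid hW) // subn0 layer1.
  exact: (map_f (fun a => (a, m))).
rewrite (block_mid hW) // => /mapP[a aj ->]; have apos := layer_pos hW jh aj.
have aP : a \in Phi D by case/andP: apos.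
have [NaW NaB] := positive_notin apos.
have kn0 : (q * h + j == 0)%N = false by apply/negbTE; lia.
rewrite /Sraw NaW NaB /= /reflected kn0.
have [ej|nej] := eqVneq j 1%N.
  have aB : a \in PiB D by rewrite ej layer1 in aj.
  rewrite aB; case: q {kn0} qm => [|q] qm.
    rewrite subn0 eqxx ej; split; last by rewrite tN tJ_PiB.
    by rewrite subn1 block_last; apply: (map_f (fun a => (- a, 1%N))).
  have -> : (m - q.+1 == m)%N = false by apply/negbTE; lia.
  split; last by rewrite tJ_PiB.
  have -> : (M.+2 - (q.+1 * h + j) = (m - q.+1) * h + 1)%N.
    by rewrite mulnBl; have := mid_leq qm (ltnW h_gt1); lia.
  rewrite (block_mid hW) //; last by lia.
  by rewrite layer1; apply: (map_f (fun a => (a, m - (m - q.+1))%N)).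
have aB : (a \in PiB D) = false.
  apply: contra_neqF nej; rewrite -layer1 => a1.
  exact: (layer_disj hW jh _ aj a1).
rewrite aB tJ_cB //; split=> //.
have := mid_leq qm (ltnW h_gt1) => le.
have -> : (M.+2 - (q * h + j) = (m - q.+1) * h + (h.+2 - j))%N.
  by rewrite mulnBl mulSn; have := mid_leq qm (leqnn h); lia.
rewrite (block_mid hW) //; [|lia|lia].
have -> : (m.+1 - (m - q) = m - (m - q.+1))%N by lia.
apply: (map_f (fun a => (a, m - (m - q.+1))%N)); apply: (cB_layer hW) aj.
by lia.
Qed.

Lemma dot_isometry w (u v : V) : w \in W -> dot (rW w *m u) (rW w *m v) = dot u v.
Proof.
move=> wW; rewrite /dot trmx_mul -mulmxA [_^T *m (_ *m v)]mulmxA.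
by rewrite (rg_orthogonal hW) // mul1mx.
Qed.

Lemma layer_orth k a b : a \in L k -> b \in L k -> a != b -> dot a b = 0.
Proof.
elim/nat_ind2: k a b => [a b|a b|k IHk a b].
- rewrite layer0 => /mapP[_ /imageP[i iW ->] ->] /mapP[_ /imageP[j jW ->] ->] ne.
  rewrite dotNr dotC dotNr opprK (orth_white (D := D)) //.
  by apply: contra_neq ne => ->.
- rewrite layer1 => /imageP[i iB ->] /imageP[j jB ->] ne.
  by rewrite (orth_black (D := D)) //; apply: contra_neq ne => ->.
rewrite layerSS => /mapP[c ck ->] /mapP[d dk ->] ne.
by rewrite dot_isometry ?cox_W // IHk //; apply: contra_neq ne => ->.
Qed.

Lemma block_commute k x y : (k <= M.+1)%N -> x \in block k -> y \in block k ->
  commute (t x.1) (t y.1).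
Proof.
move=> kM xk yk; have xP := block_Phi hW kM xk; have yP := block_Phi hW kM yk.
have [->|ne] := eqVneq x.1 y.1; first exact: commute_refl.
apply: (t_commute hW xP yP).
case/(block_indexP hW): kM xk yk => [||q j qm jh].
- rewrite block_first => /mapP[a aW ex] /mapP[b bW ey]; move: ne; rewrite ex ey /=.
  by apply: (@layer_orth 0); rewrite layer0 map_f.
- rewrite block_last => /mapP[a aB ex] /mapP[b bB ey]; move: ne; rewrite ex ey /=.
  rewrite eqr_opp dotNr dotC dotNr opprK dotC.
  by apply: (@layer_orth 1); rewrite layer1.
- rewrite (block_mid hW) // => /mapP[a aj ex] /mapP[b bj ey]; move: ne.
  by rewrite ex ey; apply: layer_orth aj bj.
Qed.

Definition block_seq f k : seq (croot D m) :=
  [seq x <- index_enum (croot D m) | (x \in f) && (ssval x \in block k)].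

Lemma mem_block_seq f k x : (x \in block_seq f k) = (x \in f) && (ssval x \in block k).
Proof. by rewrite mem_filter mem_index_enum andbT. Qed.

Lemma block_prodE f k : block_prod f k = (\prod_(x <- block_seq f k) t (ssval x).1)%g.
Proof. by rewrite /block_prod -big_filter. Qed.

Lemma block_seq_commute f k : (k <= M.+1)%N ->
  {in block_seq f k &, forall x y, commute (t (ssval x).1) (t (ssval y).1)}.
Proof.
move=> kM x y; rewrite !mem_block_seq => /andP[_ xk] /andP[_ yk].
exact: block_commute kM xk yk.
Qed.

Lemma block_prodV f k : (k <= M.+1)%N -> ((block_prod f k)^-1 = block_prod f k)%g.
Proof.
move=> kM; rewrite block_prodE; apply: prod_commute_invol => [|x].
  exact: block_seq_commute.
rewrite mem_block_seq => /andP[_ xk].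
by apply: (tV hW); apply: (block_Phi hW kM xk).
Qed.

(** The form in which the action on blocks is used: a permutation of colored
    roots that permutes the blocks, and conjugates the reflections uniformly
    on each of them, acts by conjugation on the block products. *)
Lemma block_prod_perm (p : {perm croot D m}) (r : nat -> nat) (g : nat -> gT) f :
    (forall k x, (k <= M.+1)%N ->
       (ssval (p x) \in block (r k)) = (ssval x \in block k)) ->
    (forall k x, (k <= M.+1)%N -> ssval x \in block k ->
       t (ssval (p x)).1 = (t (ssval x).1 ^ g k)%g) ->
    (forall k, (k <= M.+1)%N -> (r k <= M.+1)%N) ->
  forall k, (k <= M.+1)%N -> block_prod (p @: f) (r k) = (block_prod f k ^ g k)%g.
Proof.
move=> pr tp rM k kM; rewrite !block_prodE conjg_prod.
rewrite (@perm_prod_commute _ _ _ _ (map p (block_seq f k))); first last.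
- exact: block_seq_commute (rM _ kM).
- apply: uniq_perm; rewrite ?filter_uniq ?index_enum_uniq //.
    by rewrite map_inj_uniq ?filter_uniq ?index_enum_uniq //; apply: perm_inj.
  move=> y; rewrite mem_block_seq; apply/andP/mapP => [[/imsetP[x xf ->]]|[x + ->]].
    by rewrite pr // => xk; exists x; rewrite // mem_block_seq xf.
  by rewrite mem_block_seq => /andP[xf xk]; rewrite pr // imset_f.
rewrite big_map big_seq [RHS]big_seq; apply: eq_bigr => x.
by rewrite mem_block_seq => /andP[_ xk]; apply: tp.
Qed.

Lemma face_prodE f : face_prod f = (\prod_(i <- rev (iota 0 M.+2)) block_prod f i)%g.
Proof. exact: prod_ord_rev. Qed.

End Faces.

(** * Rotation and reflection of faces *)

Section Cofaces.
Variables (R : realType) (n : nat) (gT : finGroupType) (W : {group gT}).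
Variables (rW : mx_representation R W n) (D : root_data rW).
Hypothesis hW : irreducible_reflection_group rW.
Variables (m : nat) (m_gt0 : (0 < m)%N).
Local Notation V := 'cV[R]_n.
Local Notation t := (t rW).
Local Notation h := (coxnum D).
Local Notation block := (block D m).
Local Notation len := (abs_length rW).
Local Notation M := (m * h)%N.
Implicit Type f : {set croot D m}.

Lemma block_prod_W f k : (k <= M.+1)%N -> block_prod f k \in W.
Proof.
move=> kM; rewrite block_prodE big_seq; apply: group_prod => x.
rewrite mem_block_seq => /andP[_ xk].
by apply: tW; apply: (block_Phi hW kM xk).
Qed.

Lemma prod_blocks_W f s : {in s, forall k, (k <= M.+1)%N} ->
  (\prod_(k <- s) block_prod f k)%g \in W.
Proof.
by move=> sM; rewrite big_seq; apply: group_prod => k ks; apply/block_prod_W/sM.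
Qed.

Lemma face_prod_W f : face_prod f \in W.
Proof.
by apply: group_prod => k _; apply: block_prod_W; apply: leq_subr.
Qed.

Lemma coface_W f : coface f \in W.
Proof. by rewrite groupM ?groupV ?face_prod_W ?cox_W. Qed.

Lemma Rperm_block k x : (k <= M.+1)%N ->
  (ssval (Rperm D m_gt0 x) \in block (rotated D m k)) = (ssval x \in block k).
Proof.
move=> kM.
apply: (@perm_blocks _ (Rperm D m_gt0) (fun k x => ssval x \in block k) M.+1 (rotated D m)) kM.
- exact: rotated_le.
- by move=> j j'; apply: rotated_inj.
- by move=> j j' y; apply: (block_disj hW).
- move=> j y jM yj; rewrite permE; exact: (Rraw_block hW m_gt0 jM yj).1.
Qed.

Lemma Sperm_block k x : (k <= M.+1)%N ->
  (ssval (Sperm D m_gt0 x) \in block (reflected D m k)) = (ssval x \in block k).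
Proof.
move=> kM.
apply: (@perm_blocks _ (Sperm D m_gt0) (fun k x => ssval x \in block k) M.+1 (reflected D m)) kM.
- exact: reflected_le.
- exact: reflected_inj.
- by move=> j j' y; apply: (block_disj hW).
- move=> j y jM yj; rewrite permE; exact: (Sraw_block hW m_gt0 jM yj).1.
Qed.

Lemma block_prod_R f k : (k <= M.+1)%N ->
  block_prod (Rperm D m_gt0 @: f) (rotated D m k)
  = (block_prod f k ^ (if (h <= k)%N then 1 else (cox D)^-1))%g.
Proof.
apply: (block_prod_perm hW (r := rotated D m)
  (g := fun k => if (h <= k)%N then 1 else (cox D)^-1)%g) => [j x|j x jM xj|j].
- exact: Rperm_block.
- by rewrite permE (Rraw_block hW m_gt0 jM xj).2; case: ifP; rewrite ?conjg1.
- exact: rotated_le.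
Qed.

Lemma block_prod_S f k : (k <= M.+1)%N ->
  block_prod (Sperm D m_gt0 @: f) (reflected D m k)
  = (block_prod f k ^ (if k == 0%N then 1 else cB D))%g.
Proof.
apply: (block_prod_perm hW (r := reflected D m)
  (g := fun k => if k == 0%N then 1 else cB D)%g) => [j x|j x jM xj|j].
- exact: Sperm_block.
- by rewrite permE (Sraw_block hW m_gt0 jM xj).2; case: ifP; rewrite ?conjg1.
- exact: reflected_le.
Qed.

Local Open Scope group_scope.

(** With [prod f = A B] cut at block [h], the rotated face has product [c B
    c^-1 A]. *)
Lemma coface_R f : coface (Rperm D m_gt0 @: f) \in coface f ^: W.
Proof.
set g := _ @: f; have hM := h_leM D m_gt0.
pose A := \prod_(k <- rev (iota h (M.+2 - h))) block_prod f k.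
pose B := \prod_(k <- rev (iota 0 h)) block_prod f k.
have fE : face_prod f = A * B.
  have e : M.+2 = (h + (M.+2 - h))%N by lia.
  by rewrite face_prodE [X in iota 0 X]e iotaD rev_cat big_cat.
have gE : face_prod g = B ^ (cox D)^-1 * A.
  rewrite face_prodE.
  have e : M.+2 = ((M.+2 - h) + h)%N by lia.
  rewrite [X in iota 0 X]e iotaD rev_cat big_cat /=; congr (_ * _).
    rewrite /B conjg_prod -[(0 + (M.+2 - h))%N]addn0 iotaDl -map_rev big_map add0n.
    rewrite big_seq [RHS]big_seq; apply: eq_bigr => k; rewrite mem_rev mem_iota => kh.
    have := @block_prod_R f k; rewrite /rotated; have -> : (h <= k)%N = false by lia.
    have -> : (k + M.+2 - h = M.+2 - h + k)%N by lia.
    by apply; lia.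
  have := iotaDl h 0 (M.+2 - h); rewrite addn0 /A => ->; rewrite -map_rev big_map.
  rewrite big_seq [RHS]big_seq; apply: eq_bigr => k; rewrite mem_rev mem_iota => kh.
  have := @block_prod_R f (h + k)%N; rewrite /rotated leq_addr addKn conjg1.
  by apply; lia.
have BW : B \in W.
  by apply: prod_blocks_W => k; rewrite mem_rev mem_iota; lia.
suff -> : coface g = coface f ^ B^-1 by rewrite memJ_class // groupV.
by rewrite /coface gE fE !conjgE !invMg !invgK !mulgA !mulgKV mulgV mul1g.
Qed.

(** With [prod f = A f_0], the reflected face has product [(c_b A^-1 c_b)
    f_0], and [f_0] commutes with [c_w]. *)
Lemma coface_S f : coface (Sperm D m_gt0 @: f) \in (coface f)^-1 ^: W.
Proof.
set g := _ @: f.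
pose A := \prod_(k <- rev (iota 1 M.+1)) block_prod f k.
have fE : face_prod f = A * block_prod f 0.
  rewrite face_prodE [iota 0 M.+2]/= -cat1s rev_cat big_cat /= big_seq1 //.
have gE : face_prod g = A^-1 ^ cB D * block_prod f 0.
  rewrite face_prodE [iota 0 M.+2]/= -cat1s rev_cat big_cat /= big_seq1.
  congr (_ * _); last by have := @block_prod_S f 0; rewrite /reflected conjg1; apply.
  have -> : rev (iota 1 M.+1) = [seq (M.+2 - k)%N | k <- iota 1 M.+1].
    apply: (@eq_from_nth _ 0%N); rewrite ?size_rev ?size_map // size_iota => i iN.
    by rewrite nth_rev ?size_iota // (nth_map 0%N) ?size_iota // !nth_iota //; lia.
  rewrite /A -prodgV conjg_prod big_map.
  rewrite big_seq [RHS]big_seq; apply: eq_bigr => k; rewrite mem_iota => kM.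
  rewrite (block_prodV hW); last by lia.
  have := @block_prod_S f k; rewrite /reflected; case: eqP => [|_]; first by lia.
  by apply; lia.
have f0V := @block_prodV _ _ _ _ _ _ hW m f 0 isT.
have f0W : commute (block_prod f 0) (cW D).
  apply: commute_prod => i; rewrite inE => iW; apply: commute_sym.
  apply: commute_prod => x /andP[_]; rewrite block_first => /mapP[a aW ->] /=.
  apply: commute_sym.
  have aP : a \in Phi D by apply/Pi_Phi/PiW_Pi.
  rewrite (tN rW); have [->|ne] := eqVneq a (tnth (Pi D) i); first exact: commute_refl.
  apply: (t_commute hW aP (al_Phi D i)).
  case/imageP: aW ne => j; rewrite inE => jW -> ne.
  rewrite (orth_white (D := D)) ?inE //.
  by apply: contra_neq ne => ->.
have cBV : (cB D)^-1 = cB D by rewrite -[LHS]mulg1 -(cB_sqr D hW) mulKg.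
have cWV : (cW D)^-1 = cW D by rewrite -[LHS]mulg1 -(cW_sqr D hW) mulKg.
set f0 := block_prod f 0 in fE gE f0V f0W.
have f0_W : f0 \in W by apply: block_prod_W.
suff -> : coface g = (coface f)^-1 ^ (f0 * cW D)^-1.
  by rewrite memJ_class // groupV groupM // cW_W.
have AE : A = cox D * (coface f)^-1 * f0.
  have f0f0 : f0 * f0 = 1 by rewrite -{1}f0V mulVg.
  by rewrite /coface fE [(_ * cox D)^-1]invMg invgK mulKVg -mulgA f0f0 mulg1.
have e2 : cB D * cB D = 1 by apply: cB_sqr.
have -> : coface g = f0 * cB D * A * cW D.
  rewrite /coface gE invMg conjVg invgK f0V conjgE cBV /cox !mulgA.
  by rewrite -(mulgA _ (cB D) (cB D)) e2 mulg1.
rewrite AE /cox; move: (coface f)^-1 => v.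
rewrite conjgE invgK (invMg f0) f0V cWV -f0W !mulgA.
by rewrite -(mulgA _ (cB D) (cB D)) e2 mulg1.
Qed.

Lemma len_prod (I : Type) (s : seq I) (P : pred I) (F : I -> gT) (c : I -> nat) :
  (forall i, P i -> (len (F i) <= c i)%N) ->
  (len (\prod_(i <- s | P i) F i) <= \sum_(i <- s | P i) c i)%N.
Proof.
move=> Fc; elim/big_ind2: _ => [|x a y b xa yb|i /Fc //].
  by apply: len_le; rewrite expg0 set11.
exact: leq_trans (len_mul _ _ _) (leq_add xa yb).
Qed.

(** Each element of the face is counted in one block at most, as blocks are
    disjoint. *)
Lemma len_face_prod f : (len (face_prod f) <= #|f|)%N.
Proof.
have le1 : (len (face_prod f) <= \sum_(k < M.+2)
    \sum_(x in f | ssval x \in block (M.+1 - k)) 1)%N.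
  apply: len_prod => k _; apply: len_prod => x /andP[_ xk].
  apply: len_le; rewrite expg1; apply: (t_reflection (D := D)).
  exact: (block_Phi hW (leq_subr _ _) xk).
apply: (leq_trans le1).
under eq_bigr do rewrite big_mkcondr.
rewrite exchange_big -sum1_card; apply: leq_sum => x _ /=.
rewrite -big_mkcond sum1_card; apply/card_le1_eqP => k j kx jx.
apply/val_inj => /=.
have := block_disj hW m_gt0 (leq_subr k M.+1) (leq_subr j M.+1) kx jx.
by have := ltn_ord k; have := ltn_ord j; lia.
Qed.

Lemma mem_Gamma f : (f \in Gamma D m) =
  (len (face_prod f) == #|f|) && (#|f| + len (coface f) == len (cox D))%N.
Proof.
rewrite !inE face_prod_W /= /abs_le -/(coface f) andbC.
by case: eqP => // ->.
Qed.

(** The length of the new coface being known, subadditivity bounds the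
    length of the new product from below. *)
Lemma Gamma_transfer f (g : {set croot D m}) : #|g| = #|f| -> coface g \in coface f ^: W ->
  f \in Gamma D m -> g \in Gamma D m.
Proof.
move=> gf /imsetP[w wW cg]; rewrite !mem_Gamma => /andP[_ /eqP fE].
have lg : len (coface g) = len (coface f).
  by rewrite cg len_conj //; apply: rg_orthogonal hW.
rewrite gf lg fE eqxx andbT eqn_leq -{1}gf len_face_prod /=.
rewrite -(leq_add2r (len (coface f))) fE -lg.
have {1}-> : cox D = face_prod g * coface g by rewrite mulKVg.
exact: len_mul.
Qed.

Lemma coface_NC f : f \in Gamma D m -> coface f \in NC D.
Proof.
rewrite mem_Gamma => /andP[/eqP lf /eqP fE].
rewrite inE coface_W /abs_le /= -fE addnC.
have -> : (coface f)^-1 * cox D = face_prod f ^ cox D.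
  by rewrite /coface [(_ * cox D)^-1]invMg invgK -mulgA.
by rewrite len_conj ?cox_W // ?lf //; apply: rg_orthogonal hW.
Qed.

End Cofaces.

(** * Elements below a Coxeter element are conjugate to their inverses *)

Section StandardCoxeter.
Variables (R : realType) (n : nat) (gT : finGroupType) (W : {group gT}).
Variables (rW : mx_representation R W n) (D : root_data rW).
Hypothesis hW : irreducible_reflection_group rW.
Local Notation V := 'cV[R]_n.
Local Notation al := (tnth (Pi D)).
Local Notation cf := (coord (Pi D)).
Local Notation t := (t rW).
Local Notation black := (black D).
Local Notation T := (reflections rW).
Local Notation len := (abs_length rW).
Implicit Type J : {set 'I_n}.

(** The bipartite Coxeter element of the standard parabolic subgroup of [J]. *)
Definition sub_cox J : gT := (prod_refl D (J :&: black) * prod_refl D (J :\: black))%g.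
Local Notation cJ := sub_cox.

Lemma orth_sub_black J : {in J :&: black &, forall i j, i != j -> dot (al i) (al j) = 0}.
Proof. by move=> i j /setIP[_ iB] /setIP[_ jB]; apply: orth_black. Qed.

Lemma orth_sub_white J : {in J :\: black &, forall i j, i != j -> dot (al i) (al j) = 0}.
Proof.
by move=> i j /setDP[_ iB] /setDP[_ jB]; apply: (orth_white (D := D)); rewrite inE.
Qed.

Lemma sub_cox_W J : cJ J \in W.
Proof. by rewrite groupM ?prod_refl_W. Qed.

Lemma sub_coxT : cJ setT = cox D.
Proof. by rewrite /sub_cox setTI setTD. Qed.

Lemma prod_refl_invol J : {in J &, forall i j, i != j -> dot (al i) (al j) = 0} ->
  (prod_refl D J * prod_refl D J = 1)%g.
Proof.
move=> oJ; apply: (group_ext hW) => [||v]; rewrite ?groupM ?prod_refl_W //.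
by rewrite repr_mx1 mul1mx reprM ?prod_refl_W // prod_reflK.
Qed.

Lemma sub_coxV J : ((cJ J)^-1 = cJ J ^ prod_refl D (J :&: black))%g.
Proof.
have b2 := prod_refl_invol (@orth_sub_black J).
have w2 := prod_refl_invol (@orth_sub_white J).
rewrite conjgE /sub_cox invMg.
set b := prod_refl D _ in b2 *; set w := prod_refl D _ in w2 *.
have bV : (b^-1 = b)%g by rewrite -[LHS]mulg1 -b2 mulKg.
have wV : (w^-1 = w)%g by rewrite -[LHS]mulg1 -w2 mulKg.
by rewrite bV wV !mulgA b2 mul1g.
Qed.

Lemma prod_refl_D1 J i : {in J &, forall i j, i != j -> dot (al i) (al j) = 0} ->
  i \in J -> (prod_refl D J = t (al i) * prod_refl D (J :\ i))%g /\
             (prod_refl D J = prod_refl D (J :\ i) * t (al i))%g.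
Proof.
move=> oJ iJ.
have com j k : j \in J -> k \in J -> commute (t (al j)) (t (al k)).
  move=> jJ kJ; have [->|jk] := eqVneq j k; first exact: commute_refl.
  by apply: (t_commute hW (al_Phi D j) (al_Phi D k)); apply: oJ.
have e : (prod_refl D J = t (al i) * prod_refl D (J :\ i))%g.
  rewrite /prod_refl -big_filter -[in RHS]big_filter -(big_cons _ _ i _ xpredT (fun j => t (al j))).
  apply: perm_prod_commute => [|j k].
    apply: uniq_perm; rewrite ?filter_uniq ?index_enum_uniq //=.
      by rewrite mem_filter !inE eqxx filter_uniq ?index_enum_uniq.
    move=> j; rewrite inE !mem_filter !mem_index_enum !andbT !inE.
    by case: eqP => [->|].
  by rewrite !mem_filter => /andP[jJ _] /andP[kJ _]; apply: com.
split=> //; rewrite e; apply: commute_prod => j /setD1P[_ jJ].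
exact: com.
Qed.

Definition in_span J (v : V) : Prop := forall i, i \notin J -> cf i v = 0.

Lemma in_span_sub_cox J v : in_span J v -> in_span J (rW (cJ J) *m v).
Proof.
move=> vJ i iJ; rewrite reprM ?prod_refl_W // !cf_prod_refl ?vJ //.
- exact: orth_sub_white.
- by rewrite inE (negPf iJ) andbF.
- exact: orth_sub_black.
- by rewrite inE (negPf iJ).
Qed.

(** For a fixed vector [v], the vectors [v - w v] and [v - b v], where [b]
    and [w] are the black and white parts of [c_J], lie in the span of the
    black and of the white simple roots. As they are equal they vanish, so
    [v] is orthogonal to the span in which it lies. *)
Lemma sub_cox_fixed0 J v : in_span J v -> rW (cJ J) *m v = v -> v = 0.
Proof.
rewrite reprM ?prod_refl_W // => vJ fix_v.
have e : rW (prod_refl D (J :\: black)) *m v = rW (prod_refl D (J :&: black)) *m v.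
  by rewrite -[in RHS]fix_v (prod_reflK (@orth_sub_black J)).
have dot0 i : i \in J -> dot (al i) v = 0.
  move=> iJ; suff : refl_coef D i v = 0.
    move/eqP; rewrite /refl_coef mulf_eq0 gt_eqF ?divr_gt0 ?dot_gt0 ?al_neq0 //=.
    by move/eqP.
  have cf_in (K : {set 'I_n}) : {in K &, forall i j, i != j -> dot (al i) (al j) = 0} -> i \in K ->
      cf i (rW (prod_refl D K) *m v) = cf i v - refl_coef D i v.
    move=> oK iK; rewrite prod_reflE // linearB linear_sum /= (bigD1 i) //=.
    rewrite linearZ /= cf_al eqxx mulr1 big1 ?addr0 // => j /andP[_ /negPf ji].
    by rewrite linearZ /= cf_al ji mulr0.
  have [iB|iB] := boolP (i \in black).
    have := congr1 (cf i) e; rewrite cf_prod_refl; last first.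
    - by rewrite inE iB.
    - exact: orth_sub_white.
    rewrite cf_in; [lra | exact: orth_sub_black | by rewrite inE iJ].
  have := congr1 (cf i) e; rewrite [RHS]cf_prod_refl; last first.
  - by rewrite inE (negPf iB) andbF.
  - exact: orth_sub_black.
  rewrite cf_in; [lra | exact: orth_sub_white | by rewrite inE iB].
apply/eqP; rewrite -dot_eq0 (dot_cf D) big1 // => i _.
have [iJ|/vJ ->] := boolP (i \in J); last by rewrite mul0r.
by rewrite dotC dot0 // mulr0.
Qed.

(** Applying the white and then the black part of [c_J] to a positive root
    keeps it positive unless a simple root of [J], or its opposite, is
    reached. If this never happens the sum of the orbit is a fixed vector
    with positive coordinates. *)
Lemma sub_cox_orbit J b : b \in Phi D -> in_span J b ->
  exists k i, i \in J /\ (rW (cJ J ^+ k)%g *m b = al i \/ rW (cJ J ^+ k)%g *m b = - al i).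
Proof.
wlog bpos : b / positive D b => [hpos bP bJ|].
  have [/hpos|/hpos h] := root_sign bP; first by apply.
  have NbP : - b \in Phi D by rewrite PhiNE.
  have NbJ : in_span J (- b) by move=> i /bJ; rewrite linearN /= => ->; rewrite oppr0.
  have [k [i [iJ e]]] := h NbP NbJ; exists k, i; split=> //.
  by case: e; rewrite mulmxN => /eqP; rewrite ?eqr_opp ?eqr_oppLR => /eqP; [right|left].
move=> bP bJ; apply: contrapT => no.
have pos k : positive D (rW (cJ J ^+ k)%g *m b).
  elim: k => [|k IHk]; first by rewrite expg0 repr_mx1 mul1mx.
  have ne i (iJ : i \in J) s : rW (cJ J ^+ s)%g *m b = al i \/ rW (cJ J ^+ s)%g *m b = - al i -> False.
    by move=> e; apply: no; exists s, i.
  have ckW : (cJ J ^+ k \in W)%g by rewrite groupX ?sub_cox_W.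
  have step : rW (cJ J ^+ k.+1)%g *m b = rW (prod_refl D (J :&: black)) *m
      (rW (prod_refl D (J :\: black)) *m (rW (cJ J ^+ k)%g *m b)).
    by rewrite expgS (reprM _ _ (sub_cox_W J) ckW) (reprM _ _ (prod_refl_W _ _) (prod_refl_W _ _)).
  rewrite step.
  have [|wpos _] := positive_prod_refl (@orth_sub_white J) IHk.
    by apply/imageP => -[i /setDP[iJ _] e]; apply: (ne i iJ k); left.
  have [|//] := positive_prod_refl (@orth_sub_black J) wpos.
  apply/imageP => -[i iJB e]; have /setIP[iJ _] := iJB; apply: (ne i iJ k.+1); right.
  by rewrite step e (prod_refl_al (@orth_sub_black J)).
pose o := #[cJ J]; pose F k := rW (cJ J ^+ k)%g *m b; pose S := \sum_(k < o) F k.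
have FS k : F k.+1 = rW (cJ J) *m F k.
  by rewrite /F expgS (reprM _ _ (sub_cox_W J) (groupX _ (sub_cox_W J))).
have F0 : F 0%N = b by rewrite /F expg0 repr_mx1 mul1mx.
have Fo : F o = b by rewrite /F expg_order repr_mx1 mul1mx.
have spanX k : in_span J (F k).
  by elim: k => [|k IHk]; rewrite ?F0 // FS; apply: in_span_sub_cox.
have S0 : S = 0.
  apply: (@sub_cox_fixed0 J) => [i iJ|].
    by rewrite linear_sum big1 // => k _; apply: spanX.
  rewrite /S mulmx_sumr; under eq_bigr do rewrite -FS.
  apply: (addrI b); rewrite -{1}F0.
  by rewrite -(big_ord_recl o (fun k : 'I_o.+1 => F k)) big_ord_recr /= Fo addrC.
case/eqP: (Phi_neq0 bP); apply: (cf_inj (D := D)) => i; rewrite linear0.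
have /eqP := congr1 (cf i) S0; rewrite linear0 linear_sum /= psumr_eq0; last first.
  by move=> k _; apply: positive_cf_ge0; apply: pos.
have o_gt0 : (0 < o)%N by apply: order_gt0.
by move/allP/(_ (Ordinal o_gt0) (mem_index_enum _)) => /eqP /=; rewrite F0.
Qed.

End StandardCoxeter.

Section NoncrossingInverse.
Variables (R : realType) (n : nat) (gT : finGroupType) (W : {group gT}).
Variables (rW : mx_representation R W n) (D : root_data rW).
Hypothesis hW : irreducible_reflection_group rW.
Local Notation V := 'cV[R]_n.
Local Notation al := (tnth (Pi D)).
Local Notation cf := (coord (Pi D)).
Local Notation t := (t rW).
Local Notation black := (black D).
Local Notation T := (reflections rW).
Local Notation len := (abs_length rW).
Local Notation cJ := (sub_cox D).
Implicit Type J : {set 'I_n}.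

Lemma reflection_root x : x \in T -> exists2 a, a \in Phi D & x = t a.
Proof.
move=> xT; have [a aP e] := reflection_Phi D xT; exists a => //.
have [taW ta] := tP aP; apply: (rW_inj hW); rewrite ?ta //.
by move: xT; rewrite inE => /andP[].
Qed.

Lemma expg_T_W k x : x \in (T ^+ k)%g -> x \in W.
Proof.
elim: k x => [|k IHk] x; first by rewrite expg0 => /set1P ->; apply: group1.
rewrite expgS => /mulsgP[y z yT /IHk zW ->]; rewrite groupM //.
by move: yT; rewrite inE => /andP[].
Qed.

Lemma dim_add_line (a : V) (U : {vspace V}) k :
  (\dim U <= k)%N -> (\dim (<[a]> + U) <= k.+1)%N.
Proof.
move=> dU; apply: leq_trans (dimv_add_leqif _ _) _.
by apply: (@leq_add _ _ 1 k) => //; rewrite dim_vline; case: (a != 0).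
Qed.

(** Each reflection factor adds at most one dimension to the image of [1 -
    x]. *)
Lemma moved_space k x : x \in (T ^+ k)%g ->
  exists2 U : {vspace V}, (\dim U <= k)%N & forall v, v - rW x *m v \in U.
Proof.
elim: k x => [|k IHk] x.
  rewrite expg0 => /set1P ->; exists 0%VS; first by rewrite dimv0.
  by move=> v; rewrite repr_mx1 mul1mx subrr mem0v.
rewrite expgS => /mulsgP[y z yT zT ->]; have [U dU movU] := IHk _ zT.
have [a aP ->] := reflection_root yT.
have [taW ta] := tP aP.
exists (<[a]> + U)%VS => [|v].
  exact: dim_add_line.
rewrite (reprM _ _ taW (expg_T_W zT)).
have -> : v - rW (t a) *m (rW z *m v) =
    (rW z *m v - rW (t a) *m (rW z *m v)) + (v - rW z *m v).
  by rewrite [RHS]addrC addrA subrK.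
apply: memv_add; last exact: movU.
rewrite ta refl_mxE opprB addrC subrK.
by rewrite memvZ // memv_line.
Qed.

Definition span_simple J : {vspace V} := <<[seq al i | i <- enum J]>>%VS.

Lemma span_simpleP J v : reflect (in_span D J v) (v \in span_simple J).
Proof.
apply: (iffP idP) => [|vJ]; last first.
  rewrite (cfE D v); apply: memv_suml => i _; have [iJ|/vJ ->] := boolP (i \in J).
    by rewrite memvZ // memv_span // map_f // mem_enum.
  by rewrite scale0r mem0v.
move/(coord_span (X := in_tuple _)) => vE i iJ.
rewrite vE linear_sum big1 // => -[k k_lt] _ /=; rewrite linearZ /=.
have : (in_tuple [seq al i | i <- enum J])`_k \in [seq al i | i <- enum J].
  exact: mem_nth.
case/mapP=> j; rewrite mem_enum => jJ ->; rewrite cf_al.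
by case: eqP => [ji|_]; rewrite ?mulr0 // -ji jJ in iJ *.
Qed.

Lemma dim_span_simple J : \dim (span_simple J) = #|J|.
Proof.
have fr : free [seq al i | i <- enum J].
  have e : perm_eq (enum J ++ enum (~: J)) (enum 'I_n).
    apply: uniq_perm => [||i]; first 1 last.
    - exact: enum_uniq.
    - by rewrite mem_cat !mem_enum inE orbN.
    rewrite cat_uniq !enum_uniq andbT /=; apply/hasPn => i.
    by rewrite !mem_enum inE.
  have : free ([seq al i | i <- enum J] ++ [seq al i | i <- enum (~: J)]).
    rewrite -map_cat (perm_free (perm_map al e)) map_tnth_enum.
    exact: basis_free (Pi_basis D).
  by rewrite cat_free => /and3P[].
by move/eqP: fr; rewrite size_map -cardE.
Qed.

(** Carter's argument: the image of [1 - c_J] is the span of the [#|J|]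
    simple roots of [J], and it is contained in the span of the roots of any
    factorization; with at most [#|J|] factors the two spans coincide. *)
Lemma shortest_factor_in_span J y b r : b \in Phi D -> y \in (T ^+ r)%g -> (r < #|J|)%N ->
  cJ J = (y * t b)%g -> in_span D J b.
Proof.
move=> bP yT rJ cE; apply/span_simpleP.
have [tbW tb] := tP bP.
have [U dU movU] := moved_space yT.
pose U' := (<[b]> + U)%VS.
have dU' : (\dim U' <= #|J|)%N.
  exact: leq_trans (dim_add_line b dU) rJ.
have movU' v : v - rW (cJ J) *m v \in U'.
  rewrite cE (reprM _ _ (expg_T_W yT) tbW).
  have -> : v - rW y *m (rW (t b) *m v) =
      (v - rW (t b) *m v) + (rW (t b) *m v - rW y *m (rW (t b) *m v)).
    by rewrite addrA subrK.
  apply: memv_add; last exact: movU.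
  by rewrite tb refl_mxE opprB addrC subrK memvZ // memv_line.
pose f := linfun (mulmx (1%:M - rW (cJ J)) : V -> V).
have fE (v : V) : f v = v - rW (cJ J) *m v by rewrite lfunE /= mulmxBl mul1mx.
have dimf : \dim (f @: span_simple J) = #|J|.
  rewrite limg_dim_eq ?dim_span_simple //; apply/eqP; rewrite -subv0; apply/subvP => v.
  rewrite memv_cap memv_ker fE subr_eq0 => /andP[/span_simpleP vJ /eqP e].
  by rewrite (sub_cox_fixed0 vJ (esym e)) mem0v.
have fS : (f @: span_simple J <= span_simple J)%VS.
  apply/subvP => _ /memv_imgP[v /span_simpleP vJ ->]; rewrite fE memvB //.
    exact/span_simpleP.
  by apply/span_simpleP; apply: in_span_sub_cox.
have fU : (f @: span_simple J <= U')%VS.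
  by apply/subvP => _ /memv_imgP[v _ ->]; rewrite fE movU'.
have eS : (f @: span_simple J)%VS = span_simple J.
  by apply/eqP; rewrite eqEdim fS dimf dim_span_simple leqnn.
have eU : (f @: span_simple J)%VS = U'.
  by apply/eqP; rewrite eqEdim fU dimf.
by rewrite -eS eU; apply: (subvP (addvSl _ _)); apply: memv_line.
Qed.

Local Open Scope group_scope.

(** Induction on the number of reflections of a complement of [u]. The last
    one is made simple by conjugating by a power of [c_J], which fixes
    [c_J]. A white simple reflection cancels at the right end of [c_J]; a
    black one must first be brought to the left end by a further
    conjugation. *)
Lemma sub_cox_conj r l J u :
  u \in T ^+ l -> u^-1 * cJ J \in T ^+ r -> (l + r <= #|J|)%N ->
  exists g J', g \in W /\ u ^ g = cJ J'.
Proof.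
elim: r l J u => [|r IHr] l J u uT.
  rewrite expg0 => /set1P e _; exists 1, J; split; first exact: group1.
  by rewrite conjg1 -[LHS]mulg1 -e mulKVg.
rewrite expgSr => /mulsgP[y z yT zT e] le.
have [b bP zE] := reflection_root zT.
have cE : cJ J = u * y * t b by rewrite -mulgA -zE -e mulKVg.
have bJ : in_span D J b.
  apply: (@shortest_factor_in_span J (u * y) b (l + r)) => //; last by lia.
  by rewrite expgD; apply: mem_mulg.
have [k [i [iJ ei]]] := sub_cox_orbit bP bJ.
set d := (cJ J ^+ k)^-1.
have dW : d \in W by rewrite groupV groupX ?sub_cox_W.
have tbd : t b ^ d = t (al i).
  have := tJ hW bP (groupX k (sub_cox_W D J)); rewrite -/d => <-.
  by case: ei => ->; [|rewrite (tN rW)].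
have cd : cJ J ^ d = cJ J.
  apply/conjg_fixP/commgP; apply: commuteV; apply: commuteX; exact: commute_refl.
have cE' : cJ J = u ^ d * y ^ d * t (al i) by rewrite -tbd -!conjMg -cE cd.
have orthW := rg_orthogonal hW.
have uT' : u ^ d \in T ^+ l by apply: mem_expg_conj.
have yT' : y ^ d \in T ^+ r by apply: mem_expg_conj.
have ti2 := t_sqr hW (al_Phi D i).
have tiW := tW (al_Phi D i).
have cardJ : #|J :\ i| = #|J|.-1 by rewrite (cardsD1 i J) iJ.
have le' : (l + r <= #|J :\ i|)%N by rewrite cardJ; lia.
have [iB|iB] := boolP (i \in black).
  have iJB : i \in J :&: black by rewrite inE iJ.
  have [eb _] := prod_refl_D1 hW (@orth_sub_black _ _ _ _ _ D J) iJB.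
  have eJ : t (al i) * cJ J = cJ (J :\ i).
    rewrite /sub_cox eb !mulgA ti2 mul1g; congr (prod_refl D _ * prod_refl D _).
      by apply/setP => j; rewrite !inE andbA.
    by apply/setP => j; rewrite !inE; case: eqP => // ->; rewrite iB.
  have [||g [J' [gW gE]]] := IHr l (J :\ i) ((u ^ d) ^ t (al i)) _ _ le'.
  - exact: (mem_expg_conj orthW uT' tiW).
  - rewrite -eJ; have -> : t (al i) * cJ J = (u ^ d) ^ t (al i) * (y ^ d) ^ t (al i).
      rewrite -conjMg conjgE (tV hW (al_Phi D i)) cE' -!mulgA; do 2!congr (_ * _).
    by rewrite mulKg; apply: (mem_expg_conj orthW yT' tiW).
  by exists (d * t (al i) * g), J'; rewrite !conjgM !groupM.
have iJW : i \in J :\: black by rewrite inE iJ iB.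
have [_ ew] := prod_refl_D1 hW (@orth_sub_white _ _ _ _ _ D J) iJW.
have eJ : cJ J * t (al i) = cJ (J :\ i).
  rewrite /sub_cox ew -!mulgA ti2 mulg1; congr (prod_refl D _ * prod_refl D _).
    by apply/setP => j; rewrite !inE; case: eqP => // ->; rewrite (negPf iB) andbF.
  by apply/setP => j; rewrite !inE andbCA.
have [||g [J' [gW gE]]] := IHr l (J :\ i) (u ^ d) _ _ le'.
- exact: uT'.
- by rewrite -eJ cE' -(mulgA (u ^ d * y ^ d)) ti2 mulg1 mulKg.
by exists (d * g), J'; rewrite !conjgM !groupM.
Qed.

Lemma len_cox : (len (cox D) <= n)%N.
Proof.
have len_refl J : (len (prod_refl D J) <= #|J|)%N.
  rewrite -sum1_card; apply: len_prod => i _; apply: len_le; rewrite expg1.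
  exact: t_reflection (al_Phi D i).
apply: leq_trans (len_mul _ _ _) _.
by apply: leq_trans (leq_add (len_refl _) (len_refl _)) _; rewrite cardsC card_ord.
Qed.

Lemma NC_conj_sub_cox u : u \in NC D -> exists g J, g \in W /\ u ^ g = cJ J.
Proof.
rewrite inE => /andP[uW /eqP luE].
have lmax := len_max rW (cox D).
have [um|/mem_len uT] := leqP #|W| (len u).
  have : len (u^-1 * cox D) = 0%N by lia.
  move/len_eq0 => e; exists 1, setT; rewrite group1 sub_coxT conjg1; split=> //.
  by rewrite -[LHS]mulg1 -e mulKVg.
have [vm|/mem_len vT] := leqP #|W| (len (u^-1 * cox D)).
  have : len u = 0%N by lia.
  move/len_eq0 => ->; exists 1, set0; rewrite group1 conjg1; split=> //.
  by rewrite /sub_cox set0I set0D /prod_refl !big_set0 mulg1.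
have vT' : u^-1 * cJ setT \in T ^+ len (u^-1 * cox D) by rewrite sub_coxT.
apply: (sub_cox_conj uT vT').
by rewrite luE cardsT card_ord len_cox.
Qed.

(** A bipartite Coxeter element is inverted by its black part, by
    [sub_coxV]. *)
Lemma NC_inv u : u \in NC D -> u^-1 \in u ^: W.
Proof.
case/NC_conj_sub_cox=> g [J [gW ug]].
have e : u^-1 = u ^ (g * prod_refl D (J :&: black) * g^-1).
  by rewrite !conjgM ug -sub_coxV // -ug -conjVg conjgK.
by rewrite e; apply: memJ_class; rewrite !groupM ?groupV ?prod_refl_W.
Qed.

End NoncrossingInverse.

(** * Stability of the parabolic types *)

Section Final.
Variables (R : realType) (n : nat) (gT : finGroupType) (W : {group gT}).
Variables (rW : mx_representation R W n) (D : root_data rW).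
Hypothesis hW : irreducible_reflection_group rW.
Variables (m : nat) (m_gt0 : (0 < m)%N).
Implicit Type f : {set croot D m}.

Lemma dihedral_acts (A : {set {set croot D m}}) :
    {in A, forall f, Rperm D m_gt0 @: f \in A} ->
    {in A, forall f, Sperm D m_gt0 @: f \in A} ->
  [acts dihedral D m_gt0, on A | 'P^*]%act.
Proof.
move=> RA SA; rewrite gen_subG; apply/subsetP => p; rewrite !inE /=.
by case/orP=> /eqP ->; apply/subsetP => f fA; rewrite inE; [apply: RA | apply: SA].
Qed.

Lemma coface_S_conj f : f \in Gamma D m ->
  coface (Sperm D m_gt0 @: f) \in (coface f ^: W)%g.
Proof.
move=> fG; have := coface_S hW m_gt0 f.
by rewrite (class_eqP (NC_inv hW (coface_NC hW fG))).
Qed.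

Lemma Gamma_R f : f \in Gamma D m -> Rperm D m_gt0 @: f \in Gamma D m.
Proof.
apply: (Gamma_transfer hW m_gt0); last exact: coface_R.
exact: card_imset (@perm_inj _ _).
Qed.

Lemma Gamma_S f : f \in Gamma D m -> Sperm D m_gt0 @: f \in Gamma D m.
Proof.
move=> fG; apply: (Gamma_transfer hW m_gt0) (coface_S_conj fG) fG.
exact: card_imset (@perm_inj _ _).
Qed.

Lemma Fix_conj (p g : gT) v : p \in W -> g \in W ->
  (v \in Fix rW (p ^ g)%g) = (rW g *m v \in Fix rW p).
Proof.
move=> pW gW; apply/fixedSpaceP/fixedSpaceP; rewrite !lfunE /=.
  move/(congr1 (mulmx (rW g))); rewrite -reprM ?groupJ // conjgE mulKVg => e.
  by rewrite -reprM.
rewrite -reprM // => e; rewrite conjgE.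
by rewrite reprM ?groupV ?groupM // e repr_invK.
Qed.

Lemma parabolic_conj (p g : gT) : p \in W -> g \in W ->
  parabolic rW (p ^ g)%g = (parabolic rW p :^ g)%g.
Proof.
move=> pW gW; have giW : (g^-1 \in W)%g by rewrite groupV.
apply/setP => w; rewrite mem_conjg !inE groupJr //.
have [wW|//] := boolP (w \in W); rewrite /=.
apply/subvP/subvP => h v vp.
  by rewrite (Fix_conj v wW giW); apply: h; rewrite (Fix_conj _ pW gW) repr_invKV.
have vp' : rW g *m v \in Fix rW p by rewrite -(Fix_conj v pW gW).
by have := h _ vp'; rewrite (Fix_conj _ wW giW) repr_invK.
Qed.

Lemma parabolic_type_eq f (g : {set croot D m}) : coface g \in (coface f ^: W)%g ->
  parabolic_type g = parabolic_type f.
Proof.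
case/imsetP=> w wW e; rewrite /parabolic_type e parabolic_conj ?coface_W //.
apply/setP => X; apply/imsetP/imsetP => -[x xW ->].
  by exists (w * x)%g; rewrite ?groupM // conjsgM.
by exists (w^-1 * x)%g; rewrite ?groupM ?groupV // -conjsgM mulKVg.
Qed.

End Final.

Theorem theorem1p1 (R : realType) (n : nat) (gT : finGroupType) (W : {group gT})
    (rW : mx_representation R W n) (hW : irreducible_reflection_group rW)
    (D : root_data rW) (m : nat) (m_gt0 : (0 < m)%N) :
  (forall C : {set {set gT}},
     (exists2 p : gT, p \in NC D & C = (parabolic rW p :^: W)%g) ->
     [acts dihedral D m_gt0, on [set f in Gamma D m | parabolic_type f == C] | 'P^*]%act)
  /\
  (forall C : {set gT},
     C \in classes W ->
     [acts dihedral D m_gt0, on [set f in Gamma D m | parabolic_type_elt f == C] | 'P^*]%act).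
Proof.
split=> C _; apply: dihedral_acts => f; rewrite inE => /andP[fG /eqP <-]; rewrite inE.
- by rewrite Gamma_R ?(parabolic_type_eq hW (coface_R hW m_gt0 f)) ?eqxx.
- by rewrite Gamma_S ?(parabolic_type_eq hW (coface_S_conj hW m_gt0 fG)) ?eqxx.
- by rewrite Gamma_R //= /parabolic_type_elt; apply/eqP/class_eqP/coface_R.
- by rewrite Gamma_S //= /parabolic_type_elt; apply/eqP/class_eqP/coface_S_conj.
Qed.
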